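(* Let $G$ be any connected graph and let $U \subseteq V(G)$ be any vertex set. Then exactly one of the following two assertions holds: (i) $G$ contains a dominated comb attached to $U$; (ii) there is a normal tree $T \subseteq G$ that contains $U$ and all of whose rays are undominated in $G$. Moreover, if (ii) holds, the normal tree $T$ in (ii) can be chosen such that it contains $U$ cofinally and every component of $G - T$ has finite neighbourhood.
   Context: Graphs may be infinite (of arbitrary cardinality). A comb is the union of a ray $R$ (its spine) with infinitely many disjoint finite paths, possibly trivial, that have precisely their first vertex on $R$; the last vertices of these paths are the teeth of the comb. A comb attached to $U$ is a comb all of whose teeth lie in $U$. A subdivided star is a subdivision of an infinite star $K_{1,\infty}$; its leaves are the degree-one vertices. A subdivided star $S$ dominates a comb $C$ if infinitely many leaves of $S$ are also teeth of $C$. A dominated comb in $G$ is a comb $C \subseteq G$ that is dominated by some subdivided star $S \subseteq G$. A vertex $v$ dominates a ray $R \subseteq G$ if $G$ contains an infinite family of paths from $v$ to $R - v$ that pairwise meet only in $v$; a ray is undominated if no vertex of $G$ dominates it. A rooted tree $T \subseteq G$ is normal in $G$ if the two endvertices of every $T$-path in $G$ (a path meeting $T$ exactly in its endvertices, with at least one edge) are comparable in the tree-order of $T$ (where $x \le y$ if $x$ lies on the path from the root to $y$). $T$ contains $U$ cofinally if $U \subseteq V(T)$ and every vertex of $T$ lies below (in the tree-order) some vertex of $U$, i.e. $T$ is the down-closure of $U$. The neighbourhood of a component $C$ of $G - T$ is the set of vertices outside $C$ adjacent to a vertex of $C$. *)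

(* Defs.v *)
From HB Require Import structures.
From mathcomp Require Import all_boot.
From mathcomp Require Import boolp classical_sets functions cardinality.
Set Implicit Arguments.
Unset Strict Implicit.
Unset Printing Implicit Defensive.
Local Open Scope classical_set_scope.

(* Simple graphs, of arbitrary cardinality, whose vertices form a subset of an
   ambient type V, so that subgraphs of G are graphs over the same V. Asking V
   to be a choiceType and adj to be boolean is harmless in classical logic. *)
Record graph (V : choiceType) := Graph {
  vset : set V;
  adj : rel V;
  adj_sym : symmetric adj;
  adj_irr : irreflexive adj;
  adj_vset : forall x y, adj x y -> vset x }.

Section Graphs.
Variable V : choiceType.
Implicit Types (G H T K : graph V) (U W : set V) (R : nat -> V) (r v x y : V).

Definition subgraph H G : Prop :=
  vset H `<=` vset G /\ (forall x y, adj H x y -> adj G x y).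

(* The pair (x, s) stands for the sequence of vertices x :: s, oriented from
   its first to its last vertex; s is empty for a trivial path. *)
Definition vpath : Type := (V * seq V)%type.
Definition pverts (P : vpath) : seq V := P.1 :: P.2.
Definition pfirst (P : vpath) : V := P.1.
Definition plast (P : vpath) : V := last P.1 P.2.
Definition plength (P : vpath) : nat := size P.2.
Definition pedge (P : vpath) : rel V := fun x y =>
  ((x, y) \in zip (pverts P) P.2) || ((y, x) \in zip (pverts P) P.2).

Definition is_path G (P : vpath) : Prop :=
  [/\ vset G (pfirst P), path (adj G) P.1 P.2 & uniq (pverts P)].

Definition is_ray G R : Prop :=
  injective R /\ (forall n, adj G (R n) (R n.+1)).
Definition redge R x y : Prop :=
  exists n, (x = R n /\ y = R n.+1) \/ (y = R n /\ x = R n.+1).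

(* Nonemptiness is part of connectedness. *)
Definition connected G : Prop :=
  vset G !=set0 /\
  (forall x y, vset G x -> vset G y ->
     exists P, [/\ is_path G P, pfirst P = x & plast P = y]).

(* The teeth are not determined by the graph K alone, hence the parameter W:
   K is a comb whose set of teeth is W. *)
Definition is_comb K W : Prop :=
  exists R (Ps : set vpath),
    [/\ is_ray K R,
        infinite_set Ps,
        (forall P, Ps P ->
           is_path K P /\ [set` pverts P] `&` range R = [set pfirst P]),
        (forall P Q, Ps P -> Ps Q -> P <> Q ->
           [set` pverts P] `&` [set` pverts Q] = set0) &
    [/\ vset K = range R `|` \bigcup_(P in Ps) [set` pverts P],
        (forall x y, adj K x y <->
           redge R x y \/ (exists2 P, Ps P & pedge P x y)) &
        W = [set plast P | P in Ps]]].

(* The paths in Ps are the subdivided edges of the star with centre c. *)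
Definition is_subdivided_star K : Prop :=
  exists c (Ps : set vpath),
    [/\ infinite_set Ps,
        (forall P, Ps P ->
           [/\ is_path K P, pfirst P = c & (0 < plength P)%N]),
        (forall P Q, Ps P -> Ps Q -> P <> Q ->
           [set` pverts P] `&` [set` pverts Q] = [set c]),
        vset K = \bigcup_(P in Ps) [set` pverts P] &
        (forall x y, adj K x y <-> exists2 P, Ps P & pedge P x y)].

Definition leaves K : set V :=
  [set x | vset K x /\ exists! y, adj K x y].

Definition has_dominated_comb G U : Prop :=
  exists K W,
    [/\ is_comb K W, subgraph K G, W `<=` U &
        exists S : graph V,
          [/\ is_subdivided_star S, subgraph S G &
              infinite_set (leaves S `&` W)]].

(* v may lie on R. *)
Definition dominates_ray G v R : Prop :=
  exists Ps : set vpath,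
    [/\ infinite_set Ps,
        (forall P, Ps P ->
           [/\ is_path G P, pfirst P = v &
               [set` pverts P] `&` (range R `\ v) = [set plast P]]) &
        (forall P Q, Ps P -> Ps Q -> P <> Q ->
           [set` pverts P] `&` [set` pverts Q] = [set v])].

Definition undominated G R : Prop :=
  ~ exists2 v, vset G v & dominates_ray G v R.

Definition acyclic G : Prop :=
  forall s : seq V, ucycle (adj G) s -> (size s <= 2)%N.

Definition is_tree T : Prop := connected T /\ acyclic T.

(* The empty tree is allowed, with an irrelevant r: it is the down-closure of
   the empty set of vertices. *)
Definition rooted_tree T r : Prop :=
  vset T = set0 \/ (is_tree T /\ vset T r).

Definition tree_le T r x y : Prop :=
  exists P, [/\ is_path T P, pfirst P = r, plast P = y & x \in pverts P].

Definition is_Tpath G T (P : vpath) : Prop :=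
  [/\ is_path G P, (0 < plength P)%N &
      [set` pverts P] `&` vset T = [set pfirst P; plast P]].

Definition normal_tree G T r : Prop :=
  [/\ rooted_tree T r, subgraph T G &
      forall P, is_Tpath G T P ->
        tree_le T r (pfirst P) (plast P) \/ tree_le T r (plast P) (pfirst P)].

Definition rays_undominated G T : Prop :=
  forall R, is_ray T R -> undominated G R.

Definition contains_cofinally T r U : Prop :=
  U `<=` vset T /\
  (forall x, vset T x -> exists2 u, U u & tree_le T r x u).

Definition del_adj G T : rel V :=
  fun x y => [&& adj G x y, x \notin vset T & y \notin vset T].

Lemma del_adj_sym G T : symmetric (del_adj G T).
Proof. by move=> x y; rewrite /del_adj adj_sym [X in _ && X]andbC. Qed.

Lemma del_adj_irr G T : irreflexive (del_adj G T).
Proof. by move=> x; rewrite /del_adj adj_irr. Qed.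

Lemma del_adj_vset G T x y :
  del_adj G T x y -> (vset G `\` vset T) x.
Proof.
by case/and3P=> /adj_vset Gx /negP Tx _; split=> // ?; apply: Tx; rewrite inE.
Qed.

Definition del G T : graph V :=
  Graph (@del_adj_sym G T) (@del_adj_irr G T) (@del_adj_vset G T).

Definition is_component G K : Prop :=
  [/\ subgraph K G, connected K &
      forall H, subgraph H G -> connected H -> subgraph K H -> subgraph H K].

Definition neighbourhood G K : set V :=
  [set y | ~ vset K y /\ exists2 x, vset K x & adj G x y].

Definition has_normal_tree G U : Prop :=
  exists T r,
    [/\ normal_tree G T r, U `<=` vset T & rays_undominated G T].

End Graphs.

(* Main.v *)
(* Exclusion. The teeth of a comb converge to an end. If they lie in a normal
   tree T, then for every node x with almost all teeth above it, all but finitely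
   many teeth lie above one child of x, because the finite down-closure of x
   separates the parts of T above distinct children; so the teeth converge to a
   ray of T. A star with infinitely many leaves among the teeth then makes its
   centre dominate this ray.

   Existence. Suppose that no vertex dominates an end in the closure of U. Call
   a set dispersed if no infinite subset converges to an end. Zorn's lemma
   extends a rayless normal tree to one that contains a given dispersed set,
   since components avoiding a rayless normal tree have finite neighbourhoods.
   Starting from a single root, construct rayless normal trees T_0, T_1, ...,
   where T_(n+1) contains the (dispersed) vertex set of a maximal family of
   disjoint paths from the neighbours of T_n to U in G - T_n. Hence a component
   of G - T_(n+1) that meets U has no neighbour in T_n. So the neighbourhoods of
   the successive components containing a fixed u in U \ T, for T the union of
   the T_n, would be disjoint sets all met by a path from the root to u, and
   therefore T contains U. Likewise a component of G - T with infinitely many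
   neighbours would lie, for all large n, in a component of G - T_n that meets U,
   which leaves it no neighbour at all. Finally T is replaced by the down-closure
   of U. *)

Require Import Defs.
From HB Require Import structures.
From mathcomp Require Import all_boot.
From mathcomp Require Import boolp classical_sets functions cardinality.
Set Implicit Arguments.
Unset Strict Implicit.
Unset Printing Implicit Defensive.
Local Open Scope classical_set_scope.

(** * Walks and vertex sets converging to an end *)

Section Walks.
Context (V : choiceType) (G : graph V).
Implicit Types (x y z c w : V) (s l : seq V) (W Y Z : set V).

Lemma mem_cat_cons x s : x \in s -> exists p q, s = p ++ x :: q.
Proof. by case/splitPr=> p q; exists p, q. Qed.

(** Walks are used instead of paths because they concatenate; the end vertices must avoid [Z] too,
    and [reach_uniq] turns a walk into a path. *)
Definition reach Z x y := exists s,
  [/\ path (adj G) x s, last x s = y & forall z, z \in x :: s -> ~ Z z].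

Lemma reach_avoid Z x y : reach Z x y -> ~ Z x /\ ~ Z y.
Proof.
case=> s [_ <- av]; split; apply: av; first exact: mem_head.
exact: mem_last.
Qed.

Lemma reach_refl Z x : ~ Z x -> reach Z x x.
Proof. by move=> nZ; exists [::]; split=> // z; rewrite inE => /eqP ->. Qed.

Lemma reach_trans Z x y z : reach Z x y -> reach Z y z -> reach Z x z.
Proof.
case=> s [ps <- avs] [t [pt <- avt]]; exists (s ++ t); split.
- by rewrite cat_path ps.
- by rewrite last_cat.
move=> u; rewrite -cat_cons mem_cat => /orP[/avs //|ut].
by apply: avt; rewrite inE ut orbT.
Qed.

Lemma reach_edge Z x y : ~ Z x -> ~ Z y -> adj G x y -> reach Z x y.
Proof.
move=> nx ny xy; exists [:: y]; rewrite /= xy; split=> // z.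
by rewrite !inE => /orP[] /eqP ->.
Qed.

Lemma reach_sym Z x y : reach Z x y -> reach Z y x.
Proof.
case=> s; elim: s x => [|a s IH] x [/=].
  by move=> _ <- av; apply/reach_refl/av/mem_head.
move=> /andP[xa ps] lst av.
have ya : reach Z y a.
  by apply: IH; split=> // z zs; apply: av; rewrite inE zs orbT.
apply: (reach_trans ya); apply: reach_edge; last by rewrite adj_sym.
  by apply: av; rewrite !inE eqxx orbT.
by apply: av; rewrite mem_head.
Qed.

Lemma reach_sub Z Z' x y : Z `<=` Z' -> reach Z' x y -> reach Z x y.
Proof.
by move=> sub [s [ps ls av]]; exists s; split=> // z /av nz /sub.
Qed.

Lemma reach_uniq Z x y : reach Z x y -> exists s,
  [/\ path (adj G) x s, uniq (x :: s), last x s = y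
    & forall z, z \in x :: s -> ~ Z z].
Proof.
case=> s [ps <- av]; case/shortenP: ps => s' ps' us' sub.
exists s'; split=> // z zs; apply: av; move: zs; rewrite !inE.
by case/orP=> [->//|/sub ->]; rewrite orbT.
Qed.

Lemma path_reach Z x s : path (adj G) x s ->
  (forall z, z \in x :: s -> ~ Z z) ->
  forall y z, y \in x :: s -> z \in x :: s -> reach Z y z.
Proof.
move=> ps av.
suff H y : y \in x :: s -> reach Z x y.
  by move=> y z /H /reach_sym yx /H; apply: reach_trans.
move=> ys; case/splitPl: ys ps av => s1 s2 ly.
rewrite cat_path => /andP[p1 _] av.
exists s1; split=> // z zs; apply: av.
by rewrite -cat_cons mem_cat zs.
Qed.

(** The walk is cut right after its last vertex in [A], so [c] is where it leaves [A] for good. *)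
Lemma walk_exit (A : set V) x s : ~ A (last x s) ->
  (forall z, z \in x :: s -> ~ A z) \/
  exists s1 c s2, [/\ s = s1 ++ c :: s2, A (last x s1)
                    & forall z, z \in c :: s2 -> ~ A z].
Proof.
elim: s x => [|a s IH] x /=; first by left=> z; rewrite inE => /eqP ->.
move=> /IH[av|[s1 [c [s2 [-> A1 av]]]]]; last by right; exists (a :: s1), c, s2.
have [Ax|nAx] := pselect (A x); first by right; exists [::], a, s.
by left=> z; rewrite inE => /orP[/eqP->|/av].
Qed.

Lemma reach_exit (A : set V) Z x y : reach Z x y -> A x -> ~ A y ->
  exists x' c, [/\ A x', reach Z x x', adj G x' c & reach (Z `|` A) c y].
Proof.
case=> s [ps <- av] Ax nA; have [H|] := walk_exit nA.
  by case: (H x (mem_head _ _)).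
case=> [s1 [c [s2 [es A1 av2]]]]; exists (last x s1), c.
move: ps; rewrite es cat_path /= => /and3P[p1 pc p2].
split=> //.
  exists s1; split=> // z zs; apply: av.
  by rewrite es -cat_cons mem_cat zs.
exists s2; split=> //; first by rewrite last_cat.
move=> z zs [Zz|]; last exact: av2.
by apply: (av z) => //; rewrite es -cat_cons mem_cat zs orbT.
Qed.

Lemma first_hit (A : set V) s : (exists2 z, z \in s & A z) ->
  exists s1 a s2, [/\ s = s1 ++ a :: s2, A a & forall z, z \in s1 -> ~ A z].
Proof.
elim: s => [[]//|x s IH] [z zs Az].
have [Ax|nAx] := pselect (A x); first by exists [::], x, s.
have [|s1 [a [s2 [-> Aa av]]]] := IH.
  exists z => //; move: zs; rewrite inE => /orP[/eqP zx|//].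
  by case: nAx; rewrite -zx.
by exists (x :: s1), a, s2; split=> // u; rewrite inE => /orP[/eqP->|/av].
Qed.

Lemma infinite_nonempty_diff (W Y : set V) : infinite_set W -> finite_set Y ->
  exists2 w, W w & ~ Y w.
Proof.
by move=> iW fY; have [w [Ww Yw]] := infinite_setN0 (infinite_setD iW fY); exists w.
Qed.

(* [W] converges to an end of [G]: for every finite [Z], almost all of [W] lies
   in one component of [G - Z]. *)
Definition conc W := infinite_set W /\ forall Z, finite_set Z ->
  exists2 Y, finite_set Y &
    forall w w', W w -> W w' -> ~ Y w -> ~ Y w' -> reach Z w w'.

(* If [W] converges to an end, this says that [c] dominates that end. *)
Definition cdom c W := forall Z, finite_set Z -> ~ Z c ->
  exists2 Y, finite_set Y & forall w, W w -> ~ Y w -> reach Z c w.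

Lemma conc_sub W W' : W' `<=` W -> infinite_set W' -> conc W -> conc W'.
Proof.
move=> sub inf [_ H]; split=> // Z /H[Y fY HY]; exists Y => // w w' /sub ? /sub ?.
exact: HY.
Qed.

(* Think of disjoint paths, [f] sending every vertex of a path to an end of it:
   the last hypothesis says that [f w] is reached from [w] in [G - Z] as soon as
   [Z] avoids the fibre of [f] through [w] and [f w] itself. *)
Lemma conc_image W (f : V -> V) :
  conc W -> infinite_set (f @` W) ->
  (forall w Z, W w -> ~ Z (f w) -> (forall z, Z z -> f z <> f w) ->
     reach Z w (f w)) ->
  conc (f @` W).
Proof.
move=> [_ cW] inf blk; split=> // Z fZ; have [Y fY HY] := cW Z fZ.
(* Discarded are the images of the exceptional set [Y], the fibres that meet [Z], and [Z] itself. *)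
exists (f @` (Y `|` Z) `|` Z).
  by rewrite finite_setU; split=> //; apply: finite_image; rewrite finite_setU.
suff H w : W w -> ~ (f @` (Y `|` Z) `|` Z) (f w) -> ~ Y w /\ reach Z w (f w).
  move=> _ _ [w Ww <-] [w' Ww' <-] /(H _ Ww)[nY r] /(H _ Ww')[nY' r'].
  apply: reach_trans (reach_sym r) _; apply: reach_trans r'.
  exact: HY.
move=> Ww nY; split; first by move=> Yw; apply: nY; left; exists w => //; left.
apply: blk => //; first by move=> ?; apply: nY; right.
by move=> z Zz fz; apply: nY; left; exists z => //; right.
Qed.

(** A finite [Z] meets only finitely many fibres of [f], so the connection from [c] to almost every
    image is undisturbed. *)
Lemma cdom_image c W (f : V -> V) :
  (forall w Z, W w -> ~ Z c -> ~ Z (f w) -> (forall z, Z z -> f z <> f w) ->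
     reach Z c (f w)) ->
  cdom c (f @` W).
Proof.
move=> blk Z fZ nZ; exists (f @` Z `|` Z).
  by rewrite finite_setU; split=> //; apply: finite_image.
move=> _ [w Ww <-] nY; apply: blk => //.
  by move=> ?; apply: nY; right.
by move=> z Zz fz; apply: nY; left; exists z.
Qed.

End Walks.

(** * Normal trees *)

Section NormalTrees.
Context (V : choiceType) (G : graph V).
Implicit Types (x y z c d w r : V) (s l : seq V) (W Y Z A : set V).
Implicit Types (F : set (seq V)).

Definition nodes F : set V := [set x | exists s, F (x :: s)].
Definition le F x y := exists2 s, F (y :: s) & x \in y :: s.
Definition child F x y := exists s, F (y :: x :: s).

(** For [A] the vertex set of a tree [T], distinct vertices of [T] are linked exactly when they are
    the ends of a [T]-path. *)
Definition linked A x y :=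
  adj G x y \/ exists c d, [/\ adj G x c, reach G A c d & adj G d y].

(* A normal tree with root [r] is encoded by the set of the sequences of
   vertices [x :: ... :: r] that lead from a node down to the root, so that
   extending a tree upwards amounts to inclusion. *)
Record ntree r F : Prop := {
  nt_nil : ~ F [::];
  nt_path : forall x s, F (x :: s) -> path (adj G) x s;
  nt_uniq : forall x s, F (x :: s) -> uniq (x :: s);
  nt_last : forall x s, F (x :: s) -> last x s = r;
  nt_tail : forall x y s, F (x :: y :: s) -> F (y :: s);
  nt_fun : forall x s s', F (x :: s) -> F (x :: s') -> s = s';
  nt_norm : forall x y, nodes F x -> nodes F y -> linked (nodes F) x y ->
    le F x y \/ le F y x }.

(** * The tree-order and separation in normal trees *)

Section Order.
Context (r : V) (F : set (seq V)) (nt : ntree r F).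

Lemma tail_cat p x s : F (p ++ x :: s) -> F (x :: s).
Proof.
elim: p => [//|a [|b p] IH] /=; first exact: (nt_tail nt).
by move=> /(nt_tail nt); exact: IH.
Qed.

Lemma leE y s x : F (y :: s) -> le F x y -> x \in y :: s.
Proof. by move=> Fs [s' Fs' xs']; rewrite (nt_fun nt Fs Fs'). Qed.

Lemma le_split x y : le F x y -> exists p s,
  F (p ++ x :: s) /\ exists s0, y :: s0 = p ++ x :: s.
Proof.
by case=> s + /mem_cat_cons[p [q e]]; rewrite e => Fl; exists p, q; split=> //; exists s.
Qed.

Lemma le_refl x : nodes F x -> le F x x.
Proof. by case=> s Fs; exists s => //; rewrite mem_head. Qed.

Lemma le_nodesl x y : le F x y -> nodes F x.
Proof. by case/le_split=> p [s [/tail_cat Fs _]]; exists s. Qed.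

Lemma le_nodesr x y : le F x y -> nodes F y.
Proof. by case=> s Fs _; exists s. Qed.

Lemma le_trans x y z : le F x y -> le F y z -> le F x z.
Proof.
move=> xy /le_split[p [s [Fl [s0 e]]]]; exists s0; first by rewrite e.
by rewrite e mem_cat (leE (tail_cat Fl) xy) orbT.
Qed.

Lemma le_lin x y z : le F x z -> le F y z -> le F x y \/ le F y x.
Proof.
move=> xz yz; case: (le_split xz) => p [s [Fl [s0 e]]].
have Fz : F (z :: s0) by rewrite e.
have := leE Fz yz; rewrite e mem_cat => /orP[yp|yx]; last first.
  by right; exists s => //; exact: (tail_cat Fl).
left; case/splitPr: yp e Fl => p1 p2 e; rewrite -catA /= => /tail_cat Fl.
by exists (p2 ++ x :: s) => //; rewrite inE mem_cat mem_head !orbT.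
Qed.

Lemma le_size x y s t : F (x :: s) -> F (y :: t) -> le F x y ->
  x = y \/ (size s < size t)%N.
Proof.
move=> Fs Ft /le_split[[|a p] [s' [Fl [s0 e]]]]; first by left; case: e.
right; case: e Fl => <- e Fl.
have -> : t = p ++ x :: s' by apply: (nt_fun nt Ft).
rewrite (nt_fun nt Fs (tail_cat Fl)) size_cat /= addnS ltnS.
exact: leq_addl.
Qed.

Lemma le_anti x y : le F x y -> le F y x -> x = y.
Proof.
move=> xy yx; have [s Fs] := le_nodesl xy; have [t Ft] := le_nodesl yx.
have [//|lt1] := le_size Fs Ft xy; have [//|lt2] := le_size Ft Fs yx.
by have := ltn_trans lt1 lt2; rewrite ltnn.
Qed.

Lemma le_root x : nodes F x -> le F r x.
Proof. by case=> s Fs; exists s => //; rewrite -(nt_last nt Fs) mem_last. Qed.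

Lemma finite_down x : finite_set [set y | le F y x].
Proof.
have [[s Fs]|nx] := pselect (nodes F x).
  by apply: sub_finite_set (finite_seq (x :: s)) => y /= /(leE Fs).
suff -> : [set y | le F y x] = set0 by exact: finite_set0.
by rewrite -subset0 => y /= /le_nodesr.
Qed.

Lemma finite_downs Z : finite_set Z ->
  finite_set [set y | exists2 z, Z z & le F y z].
Proof.
move=> fZ; have -> : [set y | exists2 z, Z z & le F y z] =
    \bigcup_(z in Z) [set y | le F y z] by [].
by apply: bigcup_finite => // z _; exact: finite_down.
Qed.

Lemma child_le x y : child F x y -> le F x y.
Proof. by case=> s Fs; exists (x :: s) => //; rewrite !inE eqxx orbT. Qed.

Lemma child_neq x y : child F x y -> x <> y.
Proof.
by case=> s /(nt_uniq nt) /= /andP[+ _] e; rewrite e mem_head.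
Qed.

Lemma child_adj x y : child F x y -> adj G y x.
Proof. by case=> s /(nt_path nt) /= /andP[]. Qed.

Lemma child_lt x y z : child F x y -> le F z y -> z = y \/ le F z x.
Proof.
case=> s Fs /(leE Fs); rewrite inE => /orP[/eqP|zs]; first by left.
by right; exists s => //; exact: (nt_tail nt Fs).
Qed.

Lemma child_between x y : le F x y -> x <> y ->
  exists2 x', child F x x' & le F x' y.
Proof.
case/le_split=> p [s [Fl [s0 e]]] xy.
elim/last_ind: p Fl e => [|p a _]; first by move=> _ [/esym/xy].
rewrite -cats1 -catA /= => Fl e; exists a.
  by exists s; exact: (tail_cat Fl).
by exists s0; rewrite e // mem_cat mem_head orbT.
Qed.

(** The tree path from [x] to [y] runs entirely above [x]. *)
Lemma le_reach Z x y : le F x y -> (forall z, Z z -> ~ le F x z) ->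
  reach G Z x y.
Proof.
case/le_split=> p [s [Fl [s0 e]]] nZ.
have Fy : F (y :: s0) by rewrite e.
have pp := nt_path nt Fy.
case: p => [|a p] in Fl e.
  case: e => yx _; rewrite yx; apply: reach_refl => /nZ; apply.
  by apply: le_refl; rewrite -yx; exists s0.
case: e => ya e; subst a.
have pq : path (adj G) y (rcons p x).
  by move: pp; rewrite e -cat_rcons cat_path => /andP[].
apply: (path_reach pq).
- move=> z; rewrite -rcons_cons => zp /nZ; apply.
  have : z \in rcons (y :: p) x by [].
  rewrite mem_rcons inE => /orP[/eqP->|zyp].
    by apply: le_refl; exists s; exact: (tail_cat Fl).
  have [p1 [p2 epp]] := mem_cat_cons zyp.
  move: Fl; rewrite epp -catA /= => /tail_cat Fl.
  by exists (p2 ++ x :: s) => //; rewrite inE mem_cat mem_head !orbT.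
- by rewrite -rcons_cons mem_rcons mem_head.
- exact: mem_head.
Qed.

(** Separation in normal trees, by induction on the walk: consecutive nodes are comparable and pass
    on a common lower bound. During an excursion outside the tree, [a] is the node that was left and
    [d] the first vertex after it, so that the node of return is linked to [a]. *)
Lemma walk_meet_aux y c s : nodes F y -> path (adj G) c s -> last c s = y ->
  (nodes F c -> exists z, [/\ z \in c :: s, le F z c & le F z y]) /\
  (~ nodes F c -> forall a d, nodes F a -> adj G a d -> reach G (nodes F) d c ->
     exists z, [/\ z \in a :: s, le F z a & le F z y]).
Proof.
move=> ny; elim: s c => [|b s IH] c /=.
  move=> _ cy; rewrite cy; split=> // ny'; exists y.
  by rewrite mem_head; split=> //; exact: le_refl.
move=> /andP[cb ps] lst; have [IH1 IH2] := IH b ps lst.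
have comp a : nodes F a -> nodes F b -> linked (nodes F) a b ->
    exists z, [/\ z \in a :: b :: s, le F z a & le F z y].
  move=> na nb lnk; have [z [zs zb zy]] := IH1 nb.
  have [ab|ba] := nt_norm nt na nb lnk; last first.
    exists z; split; [by rewrite inE zs orbT|exact: le_trans ba|by []].
  have [za|az] := le_lin zb ab; first by exists z; split; rewrite // inE zs orbT.
  exists a; rewrite mem_head; split; [by []|exact: le_refl|exact: le_trans zy].
have [nb|nb] := pselect (nodes F b); split.
- by move=> nc; apply: comp => //; left.
- by move=> nc a d na ad dc; apply: comp => //; right; exists d, c.
- move=> nc; have [|z [zs zc zy]] := IH2 nb c b nc cb.
    exact: reach_refl.
  exists z; split=> //.
  by move: zs; rewrite !inE => /orP[->//|->]; rewrite !orbT.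
- move=> nc a d na ad dc; have [|z [zs zc zy]] := IH2 nb a d na ad.
    by apply: reach_trans dc _; exact: reach_edge.
  exists z; split=> //.
  by move: zs; rewrite !inE => /orP[->//|->]; rewrite !orbT.
Qed.

Lemma walk_meet x s : nodes F x -> path (adj G) x s -> nodes F (last x s) ->
  exists z, [/\ z \in x :: s, le F z x & le F z (last x s)].
Proof.
by move=> nx ps nl; have [H _] := walk_meet_aux nl ps erefl; exact: H.
Qed.

Lemma reach_meet Z x y : nodes F x -> nodes F y -> reach G Z x y ->
  exists z, [/\ ~ Z z, le F z x & le F z y].
Proof.
move=> nx ny [s [ps ls av]]; rewrite -ls in ny *.
by have [z [/av nz zx zy]] := walk_meet nx ps ny; exists z.
Qed.

Definition fray (R : nat -> V) := forall n, child F (R n) (R n.+1).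

(** * Upward rays of a normal tree *)

Section Ray.
Context (R : nat -> V) (fR : fray R).

Lemma fray_le m n : (m <= n)%N -> le F (R m) (R n).
Proof.
elim: n => [|n IH].
  rewrite leqn0 => /eqP ->; apply: le_refl.
  exact: le_nodesl (child_le (fR 0)).
rewrite leq_eqVlt => /orP[/eqP ->|/IH mn].
  by apply: le_refl; exact: le_nodesr (child_le (fR n)).
exact: le_trans mn (child_le (fR n)).
Qed.

Lemma fray_node n : nodes F (R n).
Proof. exact: le_nodesl (fray_le (leqnn n)). Qed.

Lemma fray_size n s : F (R n :: s) -> (n <= size s)%N.
Proof.
elim: n s => // n IH s Fs; have [s' Fs'] := fR n.
rewrite (nt_fun nt Fs Fs') /= ltnS; apply: IH; exact: (nt_tail nt Fs').
Qed.

(** The height of [R m] is at least [m], so it finally exceeds the heights of all nodes in [Z]. *)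
Lemma fray_avoid Z : finite_set Z ->
  exists n, forall m z, (n <= m)%N -> Z z -> ~ le F (R m) z.
Proof.
case/finite_seqP=> l ->; elim: l => [|a l [n Hn]]; first by exists 0.
suff [k Hk] : exists k, forall m, (k <= m)%N -> ~ le F (R m) a.
  exists (maxn n k) => m z; rewrite geq_max => /andP[nm km] /=.
  by rewrite inE => /orP[/eqP->|zl]; [exact: Hk|exact: Hn].
have [[s Fs]|na] := pselect (nodes F a); last first.
  by exists 0 => m _ /le_nodesr.
exists (size s).+1 => m sm le_m; have [t Ft] := fray_node m.
have := fray_size Ft; have [e|] := le_size Ft Fs le_m.
  by rewrite e in Ft; rewrite (nt_fun nt Ft Fs) leqNgt sm.
move=> ts mt; have := leq_trans sm (leq_trans mt (ltnW ts)).
by rewrite ltnn.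
Qed.

Lemma fray_inj : injective R.
Proof.
suff H m n : (m < n)%N -> R m <> R n.
  by move=> m n e; case: (ltngtP m n) => // /H; [rewrite e|rewrite -e].
case: n => // n; rewrite ltnS => /fray_le mn e.
apply: (child_neq (fR n)); apply: le_anti; first exact: child_le.
by rewrite -e.
Qed.

(** From some [n] on, no element of [Z] lies above [R n], and every later [u m] is joined to [R n]
    inside the tree above [R n]. *)
Lemma conc_above (u : nat -> V) :
  (forall n, le F (R n) (u n)) -> conc G (range u).
Proof.
move=> Ru; split.
  move=> fin; have [n Hn] := fray_avoid fin.
  by apply: (Hn n (u n)) => //; exists n.
move=> Z /fray_avoid[n Hn]; exists (u @` `I_n).
  by apply: finite_image; exact: finite_II.
suff H w : range u w -> ~ (u @` `I_n) w -> reach G Z (R n) w.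
  by move=> w w' Ww Ww' /(H _ Ww)/reach_sym r1 /(H _ Ww'); exact: reach_trans.
case=> m _ <- nm; apply: le_reach; last by move=> z; exact: Hn.
apply: le_trans (Ru m); apply: fray_le; rewrite leqNgt; apply/negP => mn.
by apply: nm; exists m.
Qed.

End Ray.

(** Only finitely many nodes lie below elements of [Z]; of any two others, the lower one is joined
    to the upper one inside the tree above it, which avoids [Z]. *)
Lemma conc_chain W : infinite_set W -> W `<=` nodes F ->
  (forall x y, W x -> W y -> le F x y \/ le F y x) -> conc G W.
Proof.
move=> iW WF ch; split=> // Z fZ; exists [set y | exists2 z, Z z & le F y z].
  exact: finite_downs.
move=> w w' Ww Ww' nw nw'; have [ww|ww] := ch _ _ Ww Ww'.
  by apply: le_reach => // z Zz le_z; apply: nw; exists z.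
by apply: reach_sym; apply: le_reach => // z Zz le_z; apply: nw'; exists z.
Qed.

(** The ray is built upwards from the root, always moving to a child above which almost all of [W]
    lies. *)
Lemma conc_ray W : conc G W -> W `<=` nodes F ->
  exists2 R, fray R & forall n, finite_set (W `&` [set w | ~ le F (R n) w]).
Proof.
move=> [iW cW] WF.
pose good x := finite_set (W `&` [set w | ~ le F x w]).
have step x : nodes F x /\ good x -> exists y, child F x y /\ good y.
  (* Deleting the finite down-closure of [x] leaves almost all of [W] in one component; the child
     below one such vertex [w0] turns out to be below all the others. *)
  move=> [nx gx]; have [Y fY HY] := cW _ (finite_down x).
  have [w0 Ww0 nw0] : exists2 w, W w &
      ~ (W `&` [set w | ~ le F x w] `|` (Y `|` [set x])) w.
    apply: infinite_nonempty_diff => //.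
    by rewrite !finite_setU; do !split=> //; exact: finite_set1.
  have xw0 : le F x w0.
    by apply: contrapT => n; apply: nw0; left.
  have [y xy yw0] : exists2 y, child F x y & le F y w0.
    apply: child_between => // xw; apply: nw0; right; right.
    by rewrite -xw.
  exists y; split=> //.
  apply: sub_finite_set fY => w [Ww nyw]; apply: contrapT => nYw.
  apply: nyw; have nY0 : ~ Y w0 by move=> ?; apply: nw0; right; left.
  (* The meeting point [z] is comparable with [y] but not below [x], so it is [y] or lies above
     it. *)
  have [z [nz zw0 zw]] := reach_meet (WF _ Ww0) (WF _ Ww) (HY _ _ Ww0 Ww nY0 nYw).
  have [yz|zy] := le_lin yw0 zw0; first exact: (le_trans yz zw).
  by case: (child_lt xy zy) => [<-//|/nz].
have {}step x : exists y, nodes F x /\ good x -> child F x y /\ good y.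
  have [/step[y Hy]|n] := pselect (nodes F x /\ good x); first by exists y.
  by exists x.
have [f Hf] := choice step.
have [w Ww] := infinite_setN0 iW.
have nr : nodes F r /\ good r.
  split; first by apply: le_nodesl (le_root (WF _ Ww)).
  rewrite /good; suff -> : W `&` [set w | ~ le F r w] = set0.
    exact: finite_set0.
  by rewrite -subset0 => v [/WF/le_root].
have gR n : nodes F (iter n f r) /\ good (iter n f r).
  elim: n => //= n /Hf[ch gd]; split=> //; exact: (le_nodesr (child_le ch)).
exists (fun n => iter n f r) => n; last by case: (gR n).
by rewrite /= /fray; case: (Hf _ (gR n)).
Qed.

End Order.

(* The neighbourhood of the component of [G - F] that contains [d]. *)
Definition nbr F d : set V :=
  [set a | nodes F a /\ exists2 c, adj G a c & reach G (nodes F) c d].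

Lemma nbr_chain r F d x y : ntree r F -> nbr F d x -> nbr F d y ->
  le F x y \/ le F y x.
Proof.
move=> nt [nx [c xc rc]] [ny [c' yc rc']]; apply: (nt_norm nt) => //.
right; exists c, c'; split=> //; last by rewrite adj_sym.
exact: reach_trans rc (reach_sym rc').
Qed.

(** By normality the neighbours form a chain; an infinite chain would converge to an end and yield a
    ray of [F]. *)
Lemma nbr_finite r F d : ntree r F -> (forall R, ~ fray F R) ->
  finite_set (nbr F d).
Proof.
move=> nt noray; apply: contrapT => inf.
have sub : nbr F d `<=` nodes F by move=> x [].
have cc : conc G (nbr F d).
  by apply: (conc_chain nt) => // x y; exact: (nbr_chain nt).
by have [R /noray] := conc_ray nt cc sub.
Qed.

End NormalTrees.

(** * Extending a normal tree *)

Section Growing.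
Context (V : choiceType) (G : graph V).
Implicit Types (x y z c d w r u : V) (s l : seq V) (W X Y Z A : set V).
Implicit Types (F : set (seq V)).

Lemma connected_reach x y : connected G -> vset G x -> vset G y ->
  reach G set0 x y.
Proof.
move=> [_ H] Gx Gy; have [[a s] [[_ /= ps _] ax sy]] := H x y Gx Gy.
rewrite /pfirst /plast /= in ax sy; subst a; exists s; split=> //.
by move=> z _ [].
Qed.

Lemma linked_sym A x y : linked G A x y -> linked G A y x.
Proof.
case=> [xy|[c [d [xc rcd dy]]]]; first by left; rewrite adj_sym.
right; exists d, c; split; last by rewrite adj_sym.
  by rewrite adj_sym.
exact: reach_sym.
Qed.

Lemma linked_sub A A' x y : A `<=` A' -> linked G A' x y -> linked G A x y.
Proof.
move=> sub [xy|[c [d [xc rcd dy]]]]; first by left.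
by right; exists c, d; split=> //; exact: reach_sub rcd.
Qed.

Lemma nodes_sub F F' : F `<=` F' -> nodes F `<=` nodes F'.
Proof. by move=> sub x [s /sub]; exists s. Qed.

Lemma le_sub F F' x y : F `<=` F' -> le F x y -> le F' x y.
Proof. by move=> sub [s /sub Fs xs]; exists s. Qed.

Lemma le_restrict r F F' x y : ntree G r F' -> F `<=` F' -> nodes F y ->
  le F' x y -> le F x y.
Proof.
move=> nt sub [s Fs] xy; exists s => //.
exact: (leE nt (sub _ Fs) xy).
Qed.

Lemma nodes_le r F F' x y : ntree G r F -> ntree G r F' -> F `<=` F' ->
  nodes F y -> le F' x y -> nodes F x.
Proof.
by move=> nt nt' sub ny /(le_restrict nt' sub ny); exact: (le_nodesl nt).
Qed.

Lemma reach_up r F F' x y : ntree G r F -> ntree G r F' -> F `<=` F' ->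
  ~ nodes F x -> le F' x y -> reach G (nodes F) y x.
Proof.
move=> nt nt' sub nx xy; apply: reach_sym.
by apply: (le_reach nt' xy) => z nz /(nodes_le nt nt' sub nz).
Qed.

(** Any two members lie in a common one, and vertices linked outside the union are linked outside
    every member. *)
Lemma ntree_bigcup r (C : set (set (seq V))) :
  (forall F, C F -> ntree G r F) -> total_on C subset ->
  ntree G r (\bigcup_(F in C) F).
Proof.
move=> ntC totC.
have common F F' : C F -> C F' -> exists2 F'', C F'' & F `<=` F'' /\ F' `<=` F''.
  by move=> CF CF'; have [s|s] := totC _ _ CF CF'; [exists F'|exists F]; do ?split.
split.
- by case=> F /ntC /nt_nil.
- by move=> x s [F /ntC nt]; exact: (nt_path nt).
- by move=> x s [F /ntC nt]; exact: (nt_uniq nt).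
- by move=> x s [F /ntC nt]; exact: (nt_last nt).
- by move=> x y s [F CF]; move=> Fl; exists F => //; exact: (nt_tail (ntC _ CF) Fl).
- move=> x s s' [F CF Fs] [F' CF' Fs']; have [F'' CF'' [s1 s2]] := common _ _ CF CF'.
  by apply: (nt_fun (ntC _ CF'')); [exact: s1 Fs|exact: s2 Fs'].
- move=> x y [s [F CF Fs]] [s' [F' CF' Fs']] lnk.
  have [F'' CF'' [s1 s2]] := common _ _ CF CF'.
  have sub : F'' `<=` \bigcup_(F in C) F by move=> l ?; exists F''.
  have [|||xy|yx] := @nt_norm _ _ _ _ (ntC _ CF'') x y.
  + by exists s; exact: s1 Fs.
  + by exists s'; exact: s2 Fs'.
  + exact: linked_sub (nodes_sub sub) lnk.
  + by left; exact: le_sub xy.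
  + by right; exact: le_sub yx.
Qed.

Lemma uniq_suffix p p' x s s' : uniq (p ++ x :: s) ->
  p ++ x :: s = p' ++ x :: s' -> s = s' :> seq V.
Proof.
elim: p p' => [|a p IH] [|a' p'] /=.
- by move=> _ [].
- by move=> /andP[nx _] [e1 e2]; move: nx; rewrite e2 mem_cat mem_head orbT.
- by move=> /andP[na _] [e1 e2]; move: na; rewrite e1 mem_cat mem_head orbT.
- by move=> /andP[_ un] [_]; exact: IH.
Qed.

Lemma chain_max r F W : ntree G r F -> finite_set W -> W !=set0 ->
  W `<=` nodes F -> (forall x y, W x -> W y -> le F x y \/ le F y x) ->
  exists2 t, W t & forall a, W a -> le F a t.
Proof.
move=> nt /finite_seqP[l ->] + WF; elim: l WF => [_ [x]//|a l IH] WF _ ch.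
have Fa : nodes F a by apply: WF; rewrite /= mem_head.
case: l IH WF ch => [_ _ _|b l IH WF ch].
  exists a; rewrite /= ?mem_head // => x; rewrite inE => /eqP ->.
  exact: le_refl.
have [||x y xl yl|t tl ht] := IH.
- by move=> x xl; apply: WF; rewrite /= inE; apply/orP; right.
- by exists b; rewrite /= mem_head.
- by apply: ch; rewrite /= inE; apply/orP; right.
have tl' : t \in a :: b :: l by rewrite inE; apply/orP; right.
have [at_|ta] := ch a t (mem_head _ _) tl'.
  by exists t => // x; rewrite /= inE => /orP[/eqP->//|]; exact: ht.
exists a; rewrite /= ?mem_head // => x; rewrite inE => /orP[/eqP->|/ht xt].
  exact: le_refl.
exact: (le_trans nt) xt ta.
Qed.

(** The neighbours of the component of [u] form a finite chain with a top [t]. Attaching a path from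
    [t] to [u] through this component keeps the tree normal, as all its neighbours are below [t]. *)
Lemma extend r F u : ntree G r F -> nbr G F u !=set0 ->
  finite_set (nbr G F u) ->
  exists F', [/\ ntree G r F', F `<=` F', nodes F' u
    & forall x, nodes F' x -> nodes F x \/ le F' x u].
Proof.
move=> nt ne fin.
have [t [[st Ft] [c tc rcu]] tmax] : exists2 t, nbr G F u t &
    forall a, nbr G F u a -> le F a t.
  apply: (chain_max nt fin ne); first by move=> x [].
  by move=> x y; exact: (nbr_chain nt).
have [q [pq uq lq avq]] := reach_uniq rcu.
(* The path is reversed, so that [l] leads from [u] through the component to [t] and on down to the
   root. *)
pose h := rev (belast c q).
have eh : u :: h = rev (c :: q) by rewrite (lastI c q) rev_rcons lq.
have mh x : (x \in u :: h) = (x \in c :: q) by rewrite eh mem_rev.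
pose l := u :: h ++ t :: st.
have lE : l = (u :: h) ++ t :: st by [].
have pl : path (adj G) u (h ++ t :: st).
  rewrite cat_path -lq /h rev_path (eq_path (e' := adj G)); last first.
    by move=> x y; exact: adj_sym.
  rewrite pq /= (nt_path nt Ft) andbT.
  suff -> : last (last c q) (rev (belast c q)) = c by rewrite adj_sym.
  by rewrite lq -[LHS]/(last c (u :: h)) eh rev_cons last_rcons.
have ul : uniq l.
  rewrite lE cat_uniq eh rev_uniq uq (nt_uniq nt Ft) andbT.
  apply/hasPn => x xt; rewrite mem_rev; apply/negP => /avq; apply.
  by apply: (le_nodesl nt (y := t)); exists st.
have ll : last u (h ++ t :: st) = r by rewrite last_cat /= (nt_last nt Ft).
(* All nonempty suffixes of [l] are added; those starting at or below [t] are already in [F]. *)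
pose F' := F `|` [set m | m != [::] /\ exists p, l = p ++ m].
have sub : F `<=` F' by move=> m; left.
have F'l : F' l by right; split=> //; exists [::].
have Ftail p x s : t :: st = p ++ x :: s -> F (x :: s).
  by move=> e; apply: (tail_cat nt (p := p)); rewrite -e.
have nodesF' x : nodes F' x -> nodes F x \/ x \in c :: q.
  case=> s [Fs|[_ [p e]]]; first by left; exists s.
  have : x \in l by rewrite e mem_cat mem_head orbT.
  rewrite lE mem_cat mh => /orP[|/mem_cat_cons[a [b eab]]]; first by right.
  by left; exists b; exact: Ftail eab.
have lcomp x y : x \in l -> y \in l -> le F' x y \/ le F' y x.
  move=> xl /mem_cat_cons[p [s e]].
  have F'y : F' (y :: s) by right; split=> //; exists p.
  move: xl; rewrite e mem_cat => /orP[|xs]; last by left; exists s.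
  case/mem_cat_cons=> p1 [p2 e']; right; exists (p2 ++ y :: s).
    by right; split=> //; exists p1; rewrite e e' -catA.
  by rewrite inE mem_cat mem_head !orbT.
have mix x s s' : F (x :: s) -> (exists p, l = p ++ x :: s') -> s = s'.
  move=> Fs [p e].
  have : x \in l by rewrite e mem_cat mem_head orbT.
  rewrite lE mem_cat mh => /orP[/avq|/mem_cat_cons[a [b eab]]].
    by case; exists s.
  rewrite (nt_fun nt Fs (Ftail _ _ _ eab)).
  apply: (uniq_suffix (p := (u :: h) ++ a) (p' := p) (x := x)).
    by rewrite -catA -eab.
  by rewrite -catA -eab -e.
(* A link to a new node [y] makes the old node [x] a neighbour of the component, hence puts it below
   [t] and on [l]. *)
have new x y : nodes F x -> y \in c :: q -> linked G (nodes F') x y ->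
    le F' x y \/ le F' y x.
  move=> nx yq lnk.
  suff /tmax : nbr G F u x.
    move=> xt; apply: lcomp; rewrite lE mem_cat ?mh ?yq //.
    by rewrite (leE nt Ft xt) orbT.
  have yu : reach G (nodes F) y u.
    by apply: (path_reach pq avq) => //; rewrite -lq mem_last.
  split=> //; case: lnk => [xy|[a [b [xa rab b_y]]]]; first by exists y.
  have rab' := reach_sub (nodes_sub sub) rab.
  exists a => //.
  apply: (reach_trans rab'); apply: (fun H => reach_trans H yu).
  by apply: reach_edge => //; [case: (reach_avoid rab')|case: (reach_avoid yu)].
exists F'; split=> //.
- split.
  + by case=> [/(nt_nil nt)|[]].
  + move=> x s [/(nt_path nt)//|[_ [[|a p] e]]].
      by case: e => <- <-.
    by case: e pl => _ ->; rewrite cat_path /= => /and3P[].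
  + move=> x s [/(nt_uniq nt)//|[_ [p e]]].
    by move: ul; rewrite e cat_uniq => /and3P[].
  + move=> x s [/(nt_last nt)//|[_ [p e]]].
    by rewrite -ll -[RHS]/(last u l) e last_cat.
  + move=> x y s [/(nt_tail nt)|[_ [p e]]]; first by left.
    by right; split=> //; exists (rcons p x); rewrite cat_rcons.
  + move=> x s s' [Fs|[_ [p e]]] [Fs'|[_ [p' e']]].
    * exact: (nt_fun nt Fs).
    * by apply: (mix x) => //; exists p'.
    * by apply/esym/(mix x) => //; exists p.
    * by apply: (uniq_suffix (p := p) (p' := p') (x := x)); rewrite -e.
  + move=> x y /nodesF'[nx|xq] /nodesF'[ny|yq] lnk.
    * have [|/(le_sub sub)|/(le_sub sub)] := nt_norm nt nx ny.
      - exact: linked_sub (nodes_sub sub) lnk.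
      - by left.
      - by right.
    * exact: new.
    * by apply/or_comm/new => //; exact: linked_sym.
    * by apply: lcomp; rewrite lE mem_cat mh ?xq ?yq.
- by exists (h ++ t :: st).
- move=> x /nodesF'[|xq]; first by left.
  right; exists (h ++ t :: st) => //.
  by rewrite -[_ :: _]/l lE mem_cat mh xq.
Qed.

(** Zorn's lemma gives a maximal extension by nodes below [X]. A ray in it would have elements of
    [X] above its later nodes, and these would converge to an end; without rays, [extend] applies to
    any missing [u]. *)
Lemma grow r F0 X : connected G -> vset G r -> ntree G r F0 -> nodes F0 r ->
  (forall R, ~ fray F0 R) -> X `<=` vset G ->
  (forall W, W `<=` X -> ~ conc G W) ->
  exists F, [/\ ntree G r F, F0 `<=` F, X `<=` nodes F, forall R, ~ fray F R
    & forall x, nodes F x -> nodes F0 x \/ exists2 u, X u & le F x u].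
Proof.
move=> cG Gr nt0 [s0 Fr] noray XG disp.
(* Nonemptiness lets the union of the empty chain satisfy [P]. *)
pose P F := [/\ ntree G r F, F !=set0 -> F0 `<=` F &
  forall x, nodes F x -> nodes F0 x \/ exists2 u, X u & le F x u].
have [|F [[nt sub cof] maxF]] := @Zorn_bigcup _ P.
  move=> C CP totC; split.
  - by apply: ntree_bigcup => // F /CP[].
  - move=> [l [F CF Fl]]; have [_ H _] := CP _ CF.
    by apply: subset_trans (H _) _; [exists l|move=> m Fm; exists F].
  - move=> x [s [F CF Fs]]; have [_ _ H] := CP _ CF.
    have [|nx|[u Xu xu]] := H x; [by exists s|by left|right; exists u => //].
    by apply: le_sub xu => m Fm; exists F.
(* An empty [F] would be properly contained in [F0], against maximality. *)
have {}sub : F0 `<=` F.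
  apply: sub; apply: contrapT => ne.
  have F_0 : F = set0 by rewrite -subset0 => l Fl; apply: ne; exists l.
  case: (maxF F0); last by split=> [//|_ //|x]; left.
  by rewrite F_0; split; [exact: sub0set|move=> /(_ _ Fr)].
have noF R : ~ fray F R.
  move=> fR.
  (* The ray leaves the rayless [F0]; from then on its nodes lie below [X]. *)
  have [n0 Hn0] : exists n, ~ nodes F0 (R n).
    apply: contrapT => H; apply: (noray R) => n.
    have [s Fs] := fR n.
    have [s' Fs'] : nodes F0 (R n.+1) by apply: contrapT => H'; apply: H; exists n.+1.
    by exists s; rewrite (nt_fun nt Fs (sub _ Fs')).
  pose R' n := R (n0 + n)%N.
  have fR' : fray F R' by move=> n; rewrite /R' addnS; exact: fR.
  have Hu n : exists u, X u /\ le F (R' n) u.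
    have [|nx|[u Xu xu]] := cof (R' n); [exact: (fray_node nt fR')| |by exists u].
    case: Hn0; apply: (nodes_le nt0 nt sub nx).
    by apply: (fray_le nt fR); exact: leq_addr.
  have [u {}Hu] := choice Hu.
  apply: (disp (range u)); first by move=> _ [n _ <-]; case: (Hu n).
  by apply: (conc_above nt fR') => n; case: (Hu n).
exists F; split=> // u Xu; apply: contrapT => nu.
have rF : nodes F r by exists s0; exact: sub.
have [a [c [na _ ac rcu]]] := reach_exit (connected_reach cG Gr (XG _ Xu)) rF nu.
have [||F' [nt' sub' nu' new]] := @extend r F u nt.
- by exists a; split=> //; exists c => //; move: rcu; rewrite set0U.
- exact: (nbr_finite u nt noF).
apply: (maxF F').
  split=> // sub''; apply: nu; exact: nodes_sub nu'.
split=> //; first by move=> _; exact: subset_trans sub'.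
move=> x /new[/cof[|[v Xv xv]]|xu]; [by left|right|right].
  by exists v => //; exact: le_sub xv.
by exists u.
Qed.

End Growing.

(** * The layers of the normal tree *)

Section Layers.
Context (V : choiceType) (G : graph V) (U : set V).
Context (cG : connected G) (UG : U `<=` vset G).
Context (nodom : forall W c, W `<=` U -> conc G W -> ~ cdom G c W).
Implicit Types (x y z c d w r u : V) (s l m : seq V) (W X Y Z A : set V).
Implicit Types (F : set (seq V)).

Lemma reach_vset Z x y : reach G Z x y -> vset G y -> vset G x.
Proof. by case=> [[|a s]] [/= ps <- _] // _; case/andP: ps => /adj_vset. Qed.

Lemma pigeonhole (W : set V) (f : V -> V) : infinite_set W ->
  finite_set (f @` W) -> exists a, infinite_set (W `&` [set w | f w = a]).
Proof.
move=> iW fin; apply: contrapT => H; apply: iW.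
apply: (@sub_finite_set _ _ (\bigcup_(a in f @` W) (W `&` [set w | f w = a]))).
  by move=> w Ww; exists (f w) => //; exists w.
apply: bigcup_finite => // a _; apply: contrapT => inf; apply: H.
by exists a.
Qed.

(* [X] consists of the vertices of a maximal family of disjoint paths in [G - F]
   from the neighbours of [F] to [U]. Given a set converging to an end in [X],
   pass to the last vertices of the paths it meets, and to neighbours in [F] of
   their first vertices: infinitely many such neighbours would yield a ray in
   [F], and otherwise one of them dominates that end. *)
Lemma separator r F : ntree G r F -> (forall R, ~ fray F R) ->
  exists X, [/\ X `<=` vset G, forall W, W `<=` X -> ~ conc G W,
    forall x, X x -> exists2 u, U u & reach G (nodes F) x u
  & forall a c u, nodes F a -> adj G a c -> U u ->
      ~ reach G (nodes F `|` X) c u].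
Proof.
move=> nt noray.
(* A walk in [G - F] from a neighbour of [F] to [U]; [D] will be a maximal disjoint family of
   these. *)
pose good m := exists c s, [/\ m = c :: s, path (adj G) c s,
  forall z, z \in m -> ~ nodes F z, exists2 a, nodes F a & adj G a c
  & U (last c s)].
pose P (D : set (seq V)) := D `<=` good /\
  forall m m' z, D m -> D m' -> z \in m -> z \in m' -> m = m'.
have [|D [[Dgood Ddisj] maxD]] := @Zorn_bigcup _ P.
  move=> C CP totC; split; first by move=> m [D /CP[H _]]; exact: H.
  move=> m m' z [D CD Dm] [D' CD' Dm']; have [s|s] := totC _ _ CD CD'.
    by case: (CP _ CD') => _ H; apply: H => //; exact: s.
  by case: (CP _ CD) => _ H; apply: H => //; exact: s.
pose X := [set z | exists2 m, D m & z \in m].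
have Xu x : X x -> exists2 u, U u & reach G (nodes F) x u.
  move=> [m /Dgood[c [s [-> ps av _ Ul]]] xm]; exists (last c s) => //.
  by apply: (path_reach ps av) => //; exact: mem_last.
exists X; split=> //.
- by move=> x /Xu[u /UG Gu /reach_vset]; exact.
- move=> W WX cW.
  (* [M z] is the member of [D] through [z], and [al m] a node of [F] adjacent to the first vertex
     of [m]; [[::]] and [r] are dummy values for other arguments. *)
  have /choice[M HM] z : exists m, X z -> D m /\ z \in m.
    have [[m Dm zm]|n] := pselect (X z); first by exists m.
    by exists [::].
  have /choice[al Hal] m : exists a, good m ->
      nodes F a /\ forall x, adj G a (head x m).
    have [[c [s [-> _ _ [a Fa ac] _]]]|n] := pselect (good m).
      by exists a.
    by exists r.
  (* [f] moves [z] forwards along its walk to [U], and [g] moves it backwards into [F]. *)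
  pose f z := last z (M z); pose g z := al (M z).
  have same w z : X w -> z \in M w -> M z = M w.
    move=> /HM[Dw _] zM.
    have Xz : X z by exists (M w).
    by have [Dz zz] := HM _ Xz; exact: (Ddisj _ _ z).
  have MP w : X w -> exists c s, [/\ M w = c :: s, path (adj G) c s,
      adj G (g w) c, f w = last c s & U (f w)].
    move=> /HM[/Dgood gm _]; have [ng adjg] := Hal _ gm.
    case: gm => c [s [e ps _ _ Ul]]; exists c, s.
    by have := adjg c; rewrite /f /g e /=; split.
  have fM w : X w -> f w \in M w.
    by move=> /MP[c [s [-> _ _ -> _]]]; exact: mem_last.
  have finf W' : W' `<=` X -> infinite_set W' -> infinite_set (f @` W').
    move=> sub iW fin; apply: iW.
    apply: (@sub_finite_set _ _ (\bigcup_(v in f @` W') [set` M v])).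
      move=> w W'w; exists (f w); first by exists w.
      rewrite /= (same w); first by case: (HM _ (sub _ W'w)).
        exact: sub.
      exact/fM/sub.
    by apply: bigcup_finite => // v _; exact: finite_seq.
  have blk (h : seq V -> V) w Z : X w -> (forall z, Z z -> h (M z) <> h (M w)) ->
      forall y z, y \in M w -> z \in M w -> reach G Z y z.
    move=> Xw HZ; have [c [s [e ps _ _ _]]] := MP _ Xw.
    rewrite e; apply: path_reach => // z zm Zz; apply: (HZ _ Zz).
    by rewrite (same w) // e.
  have fE w z : X w -> z \in M w -> f z = f w.
    move=> Xw zM; have [c [s [e _ _ _ _]]] := MP _ Xw.
    by rewrite /f (same w) // e.
  have blkf w Z : X w -> (forall z, Z z -> f z <> f w) ->
      forall y z, y \in M w -> z \in M w -> reach G Z y z.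
    move=> Xw HZ; have [c [s [e ps _ _ _]]] := MP _ Xw.
    rewrite e; apply: path_reach => // z zm Zz; apply: (HZ _ Zz).
    by apply: fE => //; rewrite e.
  (* Infinitely many attaching nodes would converge to an end and force a ray of [F]; otherwise one
     node [a] is attached to infinitely many of the walks and dominates the end of their last
     vertices. *)
  have [fin|inf] := pselect (finite_set (g @` W)); last first.
    have gF : g @` W `<=` nodes F.
      by move=> _ [w /WX/HM[/Dgood/Hal[ng _] _] <-].
    suff /(conc_ray nt) /(_ gF) [R /noray] : conc G (g @` W) by [].
    apply: conc_image => // w Z Ww nZ HZ.
    have Xw := WX _ Ww; have [_ wM] := HM _ Xw.
    have [c [s [e _ gc _ _]]] := MP _ Xw.
    have wc : reach G Z w c.
      by apply: (blk al) wM _ => //; rewrite e mem_head.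
    apply: (reach_trans wc); apply: reach_edge => //.
      by case: (reach_avoid wc).
    by rewrite adj_sym.
  have [a ia] := pigeonhole cW.1 fin.
  set Wa := W `&` _ in ia.
  have WaX : Wa `<=` X by move=> w [/WX].
  have cWa : conc G Wa by apply: conc_sub cW => // w [].
  apply: (@nodom (f @` Wa) a).
  + by move=> _ [w /WaX/MP[c [s [_ _ _ _ Uf]]] <-].
  + apply: conc_image => //; first exact: finf.
    move=> w Z /WaX Xw _ HZ; have [_ wM] := HM _ Xw.
    by apply: (blkf w) => //; exact: fM.
  + apply: cdom_image => w Z Waw na _ HZ; have Xw := WaX _ Waw.
    have [c [s [e _ gc _ _]]] := MP _ Xw.
    have cf : reach G Z c (f w).
      by apply: (blkf w) => //; [rewrite e mem_head|exact: fM].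
    apply: (fun H => reach_trans H cf); apply: reach_edge => //.
      by case: (reach_avoid cf).
    by case: Waw => _ /= <-.
- move=> a c u Fa ac Uu [s [ps ls av]].
  (* A walk avoiding both [F] and [X] could be added to [D]. *)
  have nD : ~ D (c :: s).
    by move=> Dm; apply: (av c (mem_head _ _)); right; exists (c :: s); rewrite ?mem_head.
  have dis m z : D m -> z \in m -> z \in c :: s -> False.
    by move=> Dm zm /av; apply; right; exists m.
  apply: (maxD (D `|` [set c :: s])).
    by split=> [m|sub]; [left|apply: nD; apply: sub; right].
  split.
    move=> m [/Dgood//|->]; exists c, s; split=> //; last by rewrite ls.
      by move=> z /av nz Fz; apply: nz; left.
    by exists a.
  move=> m m' z [Dm|->] [Dm'|->] // zm zm'.
  + exact: (Ddisj _ _ z).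
  + by case: (dis m z).
  + by case: (dis m' z).
Qed.

Definition layer r F :=
  [/\ ntree G r F, nodes F r & forall R, ~ fray F R].

Lemma layer_step r F : vset G r -> layer r F -> exists F',
  [/\ layer r F', F `<=` F',
      forall a u, U u -> nodes F a -> ~ nbr G F' u a
    & forall b, nodes F' b -> nodes F b \/ exists2 u, U u & reach G (nodes F) b u].
Proof.
move=> Gr [nt nr noray]; have [X [XG dX XU sep]] := separator nt noray.
have [F' [nt' sub XF' noray' cof]] := grow cG Gr nt nr noray XG dX.
exists F'; split=> //.
- by split=> //; exact: nodes_sub nr.
- move=> a u Uu Fa [_ [c ac rcu]]; apply: (sep a c u) => //.
  by apply: reach_sub rcu => z [|/XF'//]; exact: nodes_sub.
- move=> b /cof[|[x /XU[u Uu xu] bx]]; first by left.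
  have [nb|nb] := pselect (nodes F b); [by left|right; exists u => //].
  exact: (reach_trans (reach_sym (reach_up nt nt' sub nb bx))).
Qed.

Lemma layer_root r : vset G r -> layer r [set [:: r]].
Proof.
move=> Gr; split.
- split=> //.
  + by move=> x s [_ ->].
  + by move=> x s [_ ->].
  + by move=> x s [-> ->].
  + by move=> x s s' [_ ->] [_ ->].
  + by move=> x y [s [-> _]] [t [-> _]] _; left; exists [::]; rewrite ?mem_head.
- by exists [::].
- by move=> R fR; have [s] := fR 0.
Qed.

Lemma exists_ntree r : vset G r -> exists F,
  [/\ ntree G r F, U `<=` nodes F
    & forall d, ~ nodes F d -> finite_set (nbr G F d)].
Proof.
move=> Gr.
have /choice[f Hf] F : exists F', layer r F -> [/\ layer r F', F `<=` F',
      forall a u, U u -> nodes F a -> ~ nbr G F' u a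
    & forall b, nodes F' b ->
        nodes F b \/ exists2 u, U u & reach G (nodes F) b u].
  have [/(layer_step Gr)[F' HF']|n] := pselect (layer r F).
    by exists F'.
  by exists F.
pose T n := iter n f [set [:: r]].
have lT n : layer r (T n).
  by elim: n => [|n /Hf[]//]; exact: layer_root.
have subT i n : (i <= n)%N -> T i `<=` T n.
  elim: n => [|n IH]; first by rewrite leqn0 => /eqP ->.
  rewrite leq_eqVlt => /orP[/eqP -> //|/IH].
  by move=> /subset_trans; apply; case: (Hf _ (lT n)).
have ntT n : ntree G r (T n) by case: (lT n).
have away n a u : U u -> nodes (T n) a -> ~ nbr G (T n.+1) u a.
  by case: (Hf _ (lT n)) => _ _ H _; exact: H.
pose F := \bigcup_(D in range T) D.
have subF n : T n `<=` F by move=> l ?; exists (T n) => //; exists n.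
have nodesF x : nodes F x -> exists n, nodes (T n) x.
  by case=> s [_ [n _ <-] Fs]; exists n, s.
have nt : ntree G r F.
  apply: ntree_bigcup; first by move=> _ [n _ <-].
  move=> _ _ [m _ <-] [n _ <-].
  by have [/subT|/ltnW/subT] := leqP m n; [left|right].
have nbrT n u a : nbr G F u a -> nodes (T n) a -> nbr G (T n) u a.
  move=> [_ [c ac rcu]] na; split=> //; exists c => //.
  exact: reach_sub (nodes_sub (subF n)) rcu.
have new n b : nodes F b -> ~ nodes (T n) b ->
    exists2 u, U u & reach G (nodes (T n)) b u.
  move=> /nodesF[m]; elim: m => [|m IH] nb nnb.
    by case: nnb; apply: nodes_sub nb; exact: subT.
  have [nmb|nmb] := pselect (nodes (T m) b); first exact: IH.
  have [_ _ _ H] := Hf _ (lT m); have [//|[u Uu bu]] := H b nb.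
  exists u => //; apply: reach_sub bu; apply/nodes_sub/subT.
  rewrite leqNgt; apply/negP => mn; apply: nnb; apply: nodes_sub nb.
  exact: subT.
exists F; split=> //.
- move=> u Uu; apply: contrapT => nu.
  have [s [ps ls _]] := connected_reach cG Gr (UG Uu).
  (* Induction on the length of a walk from [T n] to [u]: its last vertex in [T n.+1] is a neighbour
     of the component of [u], so it is not in [T n], and the walk from it is strictly shorter. *)
  suff H k : forall n x s', (size s' <= k)%N -> path (adj G) x s' ->
      last x s' = u -> nodes (T n) x -> False.
    by apply: (H _ 0 r s (leqnn _)) => //; exists [::].
  elim: k => [|k IH] n x {}s sk {}ps {}ls nx.
    move: sk ls; rewrite leqn0 => /eqP/size0nil -> /= e; apply: nu.
    by apply: (nodes_sub (subF n)); rewrite -e.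
  have [|av|[s1 [c [s2 [es n1 av]]]]] := @walk_exit _ (nodes (T n.+1)) x s.
  + by rewrite ls => nun; apply: nu; apply: nodes_sub nun.
  + by apply: (av x (mem_head _ _)); apply: nodes_sub nx; exact: subT.
  + move: ps; rewrite es cat_path /= => /and3P[p1 pc p2].
    have ls2 : last c s2 = u by rewrite -ls es last_cat.
    have n1' : ~ nodes (T n) (last x s1).
      move=> /(away _ _ _ Uu); apply; split=> //; exists c => //.
      by exists s2.
    apply: (IH n.+1 (last x s1) (c :: s2)) => //; last 1 first.
    by rewrite /= pc.
    case: s1 {p1 n1 pc} es n1' => [_ /(_ nx)//|b s1 es _].
    move: sk; rewrite es size_cat /= addSn ltnS; apply: leq_trans.
    exact: leq_addl.
- move=> d nd; apply: contrapT => inf.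
  (* Let [a0] be a neighbour lying in layer [k], and [b] one outside layer [k.+1], which contains
     only finitely many. As [b] reaches [U] outside layer [k.+1], there [a0] is a neighbour of a
     component meeting [U], which [away] forbids. *)
  have [a0 Na0] := infinite_setN0 inf.
  have [k ka0] := nodesF _ Na0.1.
  have [b Nb nb] : exists2 b, nbr G F d b & ~ nbr G (T k.+1) d b.
    apply: infinite_nonempty_diff => //; apply: (nbr_finite _ (ntT _)).
    by case: (lT k.+1).
  have nbT : ~ nodes (T k.+1) b by move=> /(nbrT _ _ _ Nb).
  have [u Uu bu] := new _ _ Nb.1 nbT.
  have := away k a0 u Uu ka0; apply.
  have [_ [c ac rcd]] := nbrT k.+1 d a0 Na0 (nodes_sub (@subT k k.+1 (leqnSn _)) ka0).
  have [_ [c' bc' rc'd]] := Nb.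
  have rc'd' := reach_sub (nodes_sub (subF k.+1)) rc'd.
  split; first exact: nodes_sub (@subT k k.+1 (leqnSn _)) _ ka0.
  exists c => //; apply: (reach_trans rcd); apply: (reach_trans (reach_sym rc'd')).
  apply: (fun H => reach_trans H bu); apply: reach_edge => //.
    by case: (reach_avoid rc'd').
  by rewrite adj_sym.
Qed.

End Layers.

(** * Pruning, and the graph of a normal tree *)

Section Pruning.
Context (V : choiceType) (G : graph V).
Implicit Types (x y z c d w r u v : V) (s l m : seq V) (W X Y Z A U : set V).
Implicit Types (F : set (seq V)) (P Q : vpath V).

(** This encodes the down-closure of [U]; [x] and [s] only serve to name the head of [m]. *)
Definition prune F U : set (seq V) :=
  [set m | F m /\ forall x s, m = x :: s -> exists2 u, U u & le F x u].

Lemma nodes_prune F U x : nodes (prune F U) x <->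
  nodes F x /\ exists2 u, U u & le F x u.
Proof.
split=> [[s [Fs H]]|[[s Fs] H]].
  by split; [exists s|exact: (H x s)].
by exists s; split=> // ? ? [<- _].
Qed.

Lemma le_prune F U x y : nodes (prune F U) y -> le F x y -> le (prune F U) x y.
Proof.
move=> /nodes_prune[_ H] [s Fs xs]; exists s => //.
by split=> // ? ? [<- _].
Qed.

Lemma prune_closed r F U x y : ntree G r F ->
  le F x y -> nodes (prune F U) y -> nodes (prune F U) x.
Proof.
move=> nt xy /nodes_prune[_ [u Uu yu]]; apply/nodes_prune; split.
  exact: (le_nodesl nt xy).
by exists u => //; exact: (le_trans nt xy).
Qed.

(** A walk linking two remaining nodes passes through a common lower bound of them in [F]; this
    remains too, so it is one of the two. *)
Lemma ntree_prune r F U : ntree G r F -> ntree G r (prune F U).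
Proof.
move=> nt; split.
- by case=> /(nt_nil nt).
- by move=> x s [/(nt_path nt)].
- by move=> x s [/(nt_uniq nt)].
- by move=> x s [/(nt_last nt)].
- move=> x y s [Fs H]; split; first exact: (nt_tail nt Fs).
  move=> _ _ [<- _]; have [u Uu xu] := H _ _ erefl; exists u => //.
  by apply: (le_trans nt _ xu); apply: child_le; exists s.
- by move=> x s s' [Fs _] [Fs' _]; exact: (nt_fun nt Fs).
- move=> x y nx ny lnk.
  suff : le F x y \/ le F y x by case=> /le_prune; [left|right]; auto.
  have [Fx _] := (nodes_prune F U x).1 nx; have [Fy _] := (nodes_prune F U y).1 ny.
  case: lnk => [xy|[c [d [xc [s [ps ls av]] dy]]]].
    by apply: (nt_norm nt) => //; left.
  have [|||z] := walk_meet nt (x := x) (s := rcons (c :: s) y) => //.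
  + by rewrite rcons_path /= xc ps ls dy.
  + by rewrite last_rcons.
  + rewrite last_rcons in_cons mem_rcons in_cons => -[].
    case/or3P=> [/eqP-> _ xy|/eqP-> yx _|/av nz zx _]; [by left|by right|].
    by case: nz; exact: (prune_closed nt zx).
Qed.

(** If the component of [d] contains a node [b] of [F], separation puts all its neighbours below
    [b]; otherwise it avoids [F], and its neighbours are among those counted for [F]. *)
Lemma nbr_prune r F U d : ntree G r F ->
  (forall d, ~ nodes F d -> finite_set (nbr G F d)) ->
  ~ nodes (prune F U) d -> finite_set (nbr G (prune F U) d).
Proof.
move=> nt fin nd.
have [[b [nb rbd]]|none] := pselect (exists b, nodes F b /\
    reach G (nodes (prune F U)) b d).
  apply: sub_finite_set (finite_down nt b) => a [na [c ac rcd]] /=.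
  have [s [ps ls av]] := reach_trans rcd (reach_sym rbd).
  have [Fa _] := (nodes_prune F U a).1 na.
  have [||z] := walk_meet nt (x := a) (s := c :: s) Fa.
  + by rewrite /= ac.
  + by rewrite /= ls.
  rewrite in_cons => -[/orP[/eqP->|/av nz] za zb]; first by move: zb; rewrite /= ls.
  by case: nz; exact: (prune_closed nt za).
have up c : reach G (nodes (prune F U)) c d -> reach G (nodes F) c d.
  case=> s [ps ls av]; exists s; split=> // z zs nz; apply: none; exists z.
  by split=> //; apply: (path_reach ps av) => //; rewrite -ls mem_last.
apply: sub_finite_set (fin d _); last first.
  by move=> Fd; apply: none; exists d; split=> //; exact: reach_refl.
move=> a [/nodes_prune[Fa _] [c ac /up rcd]].
by split=> //; exists c.
Qed.

(** * Ends of rays, and domination by the centre of a star *)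

Lemma infinite_image_inj (T T' : Type) (A : set T) (f : T -> T') :
  infinite_set A -> (forall a b, A a -> A b -> f a = f b -> a = b) ->
  infinite_set (f @` A).
Proof.
move=> iA inj fin; apply: iA; rewrite -(eq_finite_set (A := f @` A)) //; apply: inj_card_eq.
by move=> a b /set_mem Aa /set_mem Ab; exact: inj.
Qed.

(** A finite set without [c] meets only finitely many of the paths, and every other path joins [c]
    to its vertices. *)
Lemma star_cdom c W (Ps : set (vpath V)) :
  (forall P, Ps P -> is_path G P /\ pfirst P = c) ->
  (forall P Q, Ps P -> Ps Q -> P <> Q ->
     [set` pverts P] `&` [set` pverts Q] = [set c]) ->
  W `<=` \bigcup_(P in Ps) [set` pverts P] -> cdom G c W.
Proof.
move=> HP disj WP Z fZ nZ.
have /choice[p Hp] z : exists P, (exists2 Q, Ps Q & z \in pverts Q) ->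
    Ps P /\ z \in pverts P.
  have [[Q]|n] := pselect (exists2 Q, Ps Q & z \in pverts Q); first by exists Q.
  by exists (c, [::]).
exists (\bigcup_(z in Z) [set` pverts (p z)]).
  by apply: bigcup_finite => // z _; exact: finite_seq.
move=> w /WP[P PsP wP] nY; have [[_ pP _] Pc] := HP _ PsP.
have avP z : z \in pverts P -> ~ Z z.
  move=> zP Zz; have [|Pp zp] := Hp z; first by exists P.
  apply: nY; exists z => //.
  have [<-//|PQ] := pselect (P = p z).
  have : ([set` pverts P] `&` [set` pverts (p z)]) z by [].
  by rewrite disj // => zc; case: nZ; rewrite -zc.
apply: (path_reach pP avP) => //; rewrite -Pc; exact: mem_head.
Qed.

Lemma inj_avoid (R : nat -> V) Z : injective R -> finite_set Z ->
  exists n, forall i, (n <= i)%N -> ~ Z (R i).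
Proof.
move=> inj /finite_seqP[l ->]; elim: l => [|a l [n Hn]].
  by exists 0 => i _ /=; rewrite in_nil.
have [[j Rj]|no] := pselect (exists j, R j = a).
  exists (maxn n j.+1) => i; rewrite geq_max => /andP[ni ji] /=.
  rewrite inE => /orP[/eqP|]; last exact: Hn.
  by rewrite -Rj => /inj e; rewrite e ltnn in ji.
exists n => i ni /=; rewrite inE => /orP[/eqP e|]; last exact: Hn.
by apply: no; exists i.
Qed.

Lemma ray_conc (R : nat -> V) : is_ray G R -> conc G (range R).
Proof.
move=> [inj adjR]; split.
  move=> fin; have [n Hn] := inj_avoid inj fin.
  by apply: (Hn n (leqnn n)); exists n.
move=> Z /(inj_avoid inj)[n Hn]; exists (R @` `I_n).
  by apply: finite_image; exact: finite_II.
suff H w : range R w -> ~ (R @` `I_n) w -> reach G Z (R n) w.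
  by move=> w w' Ww Ww' /(H _ Ww)/reach_sym r1 /(H _ Ww'); exact: reach_trans.
case=> i _ <- ni; have : (n <= i)%N.
  by rewrite leqNgt; apply/negP => lin; apply: ni; exists i.
elim: i {ni} => [|i IH]; first by rewrite leqn0 => /eqP n0; rewrite -n0; apply/reach_refl/Hn.
rewrite leq_eqVlt => /orP[/eqP <-|]; first exact/reach_refl/Hn.
rewrite ltnS => ni; apply: reach_trans (IH ni) _.
apply: reach_edge => //; apply: Hn => //; exact: leqW.
Qed.

(** [W] consists of the last vertices of the dominating paths; they are distinct because the paths
    meet only in [v]. *)
Lemma dominates_cdom v (R : nat -> V) : dominates_ray G v R ->
  exists W, [/\ infinite_set W, W `<=` range R & cdom G v W].
Proof.
move=> [Ps [iPs HP disj]]; exists (@plast V @` Ps); split.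
- apply: infinite_image_inj => // P Q PsP PsQ e; apply: contrapT => PQ.
  have [_ _ eP] := HP _ PsP.
  have [_ nv] : (range R `\ v) (plast P).
    suff : ([set` pverts P] `&` (range R `\ v)) (plast P) by case.
    by rewrite eP.
  apply: nv; suff : ([set` pverts P] `&` [set` pverts Q]) (plast P).
    by rewrite disj.
  by split; [|rewrite /= e]; exact: mem_last.
- move=> _ [P PsP <-]; have [_ _ eP] := HP _ PsP.
  suff : ([set` pverts P] `&` (range R `\ v)) (plast P) by case=> _ [].
  by rewrite eP.
- apply: (star_cdom (Ps := Ps)) => //; first by move=> P /HP[].
  by move=> _ [P PsP <-]; exists P => //; exact: mem_last.
Qed.

Lemma reach_connected (H : graph V) : vset H !=set0 ->
  (forall x y, vset H x -> vset H y -> reach H set0 x y) -> connected H.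
Proof.
move=> ne HH; split=> // x y Hx Hy.
have [s [ps us ls _]] := reach_uniq (HH x y Hx Hy).
by exists (x, s); split.
Qed.

(** * The graph of an encoded normal tree *)

Section TreeGraph.
Context (r : V) (F : set (seq V)) (nt : ntree G r F).

Definition tadj : rel V := fun x y => `[< child F x y \/ child F y x >].

Lemma tadj_sym : symmetric tadj.
Proof.
by move=> x y; apply/idP/idP => /asboolP[]; move=> ?; apply/asboolP; [right|left|right|left].
Qed.

Lemma tadj_irr : irreflexive tadj.
Proof.
by move=> x; apply/negbTE/negP => /asboolP[] /(child_neq nt).
Qed.

Lemma tadj_vset x y : tadj x y -> nodes F x.
Proof.
by case/asboolP=> /child_le; [exact: (le_nodesl nt)|exact: le_nodesr].
Qed.

Definition tgraph : graph V := Graph tadj_sym tadj_irr tadj_vset.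

Lemma tgraph_path x s : F (x :: s) -> path tadj x s.
Proof.
elim: s x => // y s IH x Fs /=; rewrite IH ?andbT; last exact: (nt_tail nt Fs).
by apply/asboolP; right; exists s.
Qed.

Lemma tgraph_sub : vset G r -> subgraph tgraph G.
Proof.
move=> Gr; split=> [x [[|y s] Fs]|x y /asboolP[]].
- by have /= -> := nt_last nt Fs.
- by have /= /andP[/adj_vset] := nt_path nt Fs.
- by move=> /(child_adj nt); rewrite adj_sym.
- by move=> /(child_adj nt).
Qed.

Lemma tgraph_connected : nodes F !=set0 -> connected tgraph.
Proof.
move=> ne; apply: reach_connected => // x y [s Fs] [t Ft].
apply: (@reach_trans _ _ _ _ r); [|apply: reach_sym].
  exists s; split; [exact: tgraph_path|exact: (nt_last nt Fs)|by move=> z _ []].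
exists t; split; [exact: tgraph_path|exact: (nt_last nt Ft)|by move=> z _ []].
Qed.

Lemma seq_max (T : eqType) (f : T -> nat) (t : seq T) : t != [::] ->
  exists2 a, a \in t & forall b, b \in t -> (f b <= f a)%N.
Proof.
elim: t => // a [|b t] IH _.
  by exists a; rewrite ?mem_head // => y; rewrite inE => /eqP ->.
have [//|x xs Hx] := IH; have [ax|xa] := leqP (f a) (f x).
  exists x; first by rewrite in_cons xs orbT.
  by move=> y; rewrite in_cons => /orP[/eqP->|/Hx].
exists a; rewrite ?mem_head // => y; rewrite inE => /orP[/eqP->//|/Hx yx].
exact: leq_trans yx (ltnW xa).
Qed.

(** On a cycle, both neighbours of a vertex of greatest height would be its unique parent. *)
Lemma tgraph_acyclic : acyclic tgraph.
Proof.
move=> s; rewrite /ucycle => /andP[cs us]; rewrite leqNgt; apply/negP => s2.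
have /choice[dep Hdep] x : exists n, forall t, F (x :: t) -> size t = n.
  have [[t Ft]|n] := pselect (nodes F x); last by exists 0 => t Ft; case: n; exists t.
  by exists (size t) => t' /(nt_fun nt Ft) ->.
have [|x xs Hx] := seq_max dep (t := s); first by case: (s) s2.
have [i s' e] := rot_to xs.
have mem_s y : y \in s = (y \in x :: s') by rewrite -e mem_rot.
move: cs us s2; rewrite -(rot_cycle i) -(rot_uniq i) -(size_rot i) e.
case: s' {e} mem_s => // y s' mem_s; elim/last_ind: s' mem_s => // s' z _ mem_s.
rewrite /= rcons_path last_rcons => /and3P[xy _ zx] /and3P[_ yz _] _.
have up a : a \in s -> adj tgraph x a -> child F a x.
  move=> /Hx le_ax /asboolP[] // [t Fa].
  move: le_ax; rewrite -(Hdep _ _ Fa) /= -(Hdep _ _ (nt_tail nt Fa)).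
  by rewrite ltnn.
have [||t Fy] := up y => //; first by rewrite mem_s !inE eqxx orbT.
have [||t' Fz] := up z.
- by rewrite mem_s !inE mem_rcons inE eqxx !orbT.
- by rewrite adj_sym.
have [eyz _] := nt_fun nt Fy Fz.
by move: yz; rewrite eyz mem_rcons mem_head.
Qed.

Lemma le_tree_le x y : le F x y -> tree_le tgraph r x y.
Proof.
case=> s Fs xs; pose q := rev (belast y s).
have e : r :: q = rev (y :: s) by rewrite (lastI y s) rev_rcons (nt_last nt Fs).
exists (r, q); split.
- split.
  + rewrite /pfirst /=; apply: (le_nodesl nt (y := y)); apply: (le_root nt).
    by exists s.
  + rewrite /= -(nt_last nt Fs) /q rev_path (eq_path (e' := tadj)).
      exact: tgraph_path.
    by move=> a b; exact: tadj_sym.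
  + by rewrite -[pverts _]/(r :: q) e rev_uniq (nt_uniq nt Fs).
- by [].
- by have : last r (r :: q) = y by rewrite e rev_cons last_rcons.
- by rewrite -[pverts _]/(r :: q) e mem_rev.
Qed.

Lemma tpath_linked P : is_Tpath G tgraph P ->
  linked G (nodes F) (pfirst P) (plast P).
Proof.
case: P => x s [[_ /= ps us] s0 e].
elim/last_ind: s ps us s0 e => // s y _; rewrite rcons_path => /andP[ps sy].
rewrite /pverts /= mem_rcons rcons_uniq inE negb_or => /and3P[/andP[xy xs] ys us] _ e.
have -> : plast (x, rcons s y) = y by rewrite /plast last_rcons.
rewrite /pfirst /=.
case: s ps sy xs ys us e => [|c s] /=; first by left.
move=> /andP[xc ps] sy xs ys us e; right; exists c, (last c s); split=> //.
exists s; split=> // z zs Fz.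
have : ([set` pverts (x, rcons (c :: s) y)] `&` nodes F) z.
  by split=> //=; rewrite inE -rcons_cons mem_rcons inE zs !orbT.
rewrite [X in X z]e => -[/= zx|/=].
  by move: xs; rewrite -[x]zx zs.
rewrite /plast /= last_rcons => zy.
by move: ys; rewrite -zy zs.
Qed.

Lemma tgraph_normal : vset G r -> normal_tree G tgraph r.
Proof.
move=> Gr; split; [|exact: tgraph_sub|].
- have [e|ne] := pselect (nodes F = set0); [by left|right].
  have {}ne : nodes F !=set0 by apply/set0P/eqP.
  split; first by split; [exact: tgraph_connected|exact: tgraph_acyclic].
  by have [x Fx] := ne; exact: (le_nodesl nt (le_root nt Fx)).
- move=> P tP; have [_ _ e] := tP.
  have nF x : ([set pfirst P; plast P]) x -> nodes F x by rewrite -e => -[].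
  have [|||/le_tree_le|/le_tree_le] := @nt_norm _ _ _ _ nt (pfirst P) (plast P).
  + by apply: nF; left.
  + by apply: nF; right.
  + exact: tpath_linked.
  + by left.
  + by right.
Qed.

(** The set [C] of vertices reachable from [d] carries a connected graph [H] containing [K], so by
    maximality [K] has all of [C], and its neighbourhood lies in [nbr G F d]. *)
Lemma tgraph_component (K : graph V) :
  (forall d, ~ nodes F d -> finite_set (nbr G F d)) ->
  is_component (del G tgraph) K -> finite_set (neighbourhood G K).
Proof.
move=> fin [[KG KA] [[d Kd] Kc] Kmax].
have nd : ~ nodes F d by have [] := KG _ Kd.
have delE x y : del_adj G tgraph x y <-> [/\ adj G x y, ~ nodes F x & ~ nodes F y].
  split=> [/and3P[xy /negP nx /negP ny]|[xy nx ny]].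
    by split=> // n; [apply: nx|apply: ny]; exact: mem_set.
  by apply/and3P; split=> //; apply/negP => /set_mem.
pose C := [set x | vset G x /\ reach G (nodes F) x d].
pose e x y := del_adj G tgraph x y && `[< C x >].
have eC x y : adj G x y -> ~ nodes F x -> ~ nodes F y -> C x -> C y.
  move=> xy nx ny [_ xd]; split; first by rewrite adj_sym in xy; exact: adj_vset xy.
  by apply: reach_trans xd; apply: reach_edge => //; rewrite adj_sym.
have esym : symmetric e.
  suff H x y : e x y -> e y x by move=> x y; apply/idP/idP; exact: H.
  move=> /andP[xy /asboolP Cx]; apply/andP; split; first by rewrite del_adj_sym.
  by apply/asboolP; move/delE: xy => [xy nx ny]; exact: eC xy nx ny Cx.
have eirr : irreflexive e by move=> x; rewrite /e del_adj_irr.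
have eset x y : e x y -> C x by case/andP=> _ /asboolP.
pose H := Graph esym eirr eset.
have reachK x y : vset K x -> vset K y -> reach G (nodes F) x y.
  move=> Kx Ky; have [[a s] [[_ /= ps _] ax ls]] := Kc _ _ Kx Ky.
  rewrite /pfirst /plast /= in ax ls; subst a.
  have nx : ~ nodes F x by have [] := KG _ Kx.
  exists s; split=> //.
    by apply: sub_path ps => a b /KA/delE[].
  elim: s x nx ps {ls Kx} => [|a s IH] x nx /= ps z; first by rewrite inE => /eqP->.
  move: ps => /andP[/KA/delE[_ _ na] ps].
  by rewrite inE => /orP[/eqP->//|]; exact: IH.
have KC x : vset K x -> C x.
  by move=> Kx; split; [case: (KG _ Kx)|exact: reachK].
have [HK _] : subgraph H K.
  apply: Kmax.
  - by split=> [x [Gx xd]|x y /andP[]//]; have [nx _] := reach_avoid xd; split.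
  - have toD x : C x -> reach H set0 x d.
      move=> Cx; have [s [ps ls av]] := Cx.2.
      exists s; split=> //; last by move=> z _ [].
      elim: s x Cx ps {ls} av => // a s IH x Cx /= /andP[xa ps] av.
      have nx : ~ nodes F x by apply: av; rewrite mem_head.
      have na : ~ nodes F a by apply: av; rewrite !inE eqxx orbT.
      have exa : e x a by apply/andP; split; [apply/delE|apply/asboolP].
      rewrite exa IH //; first exact: eC xa nx na Cx.
      by move=> z zs; apply: av; rewrite inE zs orbT.
    apply: reach_connected; first by exists d; exact: KC.
    by move=> x y /toD xd /toD yd; exact: reach_trans xd (reach_sym yd).
  - split=> // x y Kxy.
    apply/andP; split; first exact: KA.
    by apply/asboolP/KC; exact: adj_vset Kxy.
apply: sub_finite_set (fin d nd) => y [nKy [x Kx xy]].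
have Ty : nodes F y.
  apply: contrapT => ny; apply: nKy; apply: HK.
  by apply: eC xy _ ny (KC _ Kx); case: (KG _ Kx).
split=> //; exists x; first by rewrite adj_sym.
by case: (KC _ Kx).
Qed.

(** The ray [R] need not run upwards throughout, but almost all of it lies above each vertex of some
    upward ray [L]. Vertices of [U] chosen above [L] converge to the same end, so that a vertex
    dominating [R] contradicts [nodom]. *)
Lemma tgraph_undominated U :
  (forall W c, W `<=` U -> conc G W -> ~ cdom G c W) -> vset G r ->
  (forall x, nodes F x -> exists2 u, U u & le F x u) ->
  rays_undominated G tgraph.
Proof.
move=> nodom Gr cof R [inj adjR] [v _ /dominates_cdom[W [iW WR cW]]].
have [_ subadj] := tgraph_sub Gr.
have cR : conc G (range R).
  by apply: ray_conc; split=> // n; exact: subadj.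
have RF : range R `<=` nodes F by move=> _ [n _ <-]; exact: tadj_vset (adjR n).
have [L fL almost] := conc_ray nt cR RF.
have /choice[u Hu] n : exists u, U u /\ le F (L n) u.
  by have [u Uu Lu] := cof _ (fray_node nt fL n); exists u.
apply: (nodom (range u) v).
- by move=> _ [n _ <-]; case: (Hu n).
- by apply: (conc_above nt fL) => n; case: (Hu n).
move=> Z fZ nZ; have [n Hn] := fray_avoid nt fL fZ.
exists (u @` `I_n); first by apply: finite_image; exact: finite_II.
have [Y fY HY] := cW Z fZ nZ.
(* This [w] is reached from [v] and lies above [L n], so it joins [v] to all later [u k] outside
   [Z]. *)
have [w Ww nw] : exists2 w, W w & ~ (Y `|` range R `&` [set w | ~ le F (L n) w]) w.
  by apply: infinite_nonempty_diff => //; rewrite finite_setU.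
have Lw : le F (L n) w.
  by apply: contrapT => nle; apply: nw; right; split=> //; exact: WR.
have vw : reach G Z v w by apply: HY => // ?; apply: nw; left.
have avL z : Z z -> ~ le F (L n) z by exact: Hn.
move=> _ [k _ <-] nk; apply: reach_trans vw _.
apply: reach_trans (reach_sym (le_reach nt Lw avL)) _.
apply: (le_reach nt) => //; apply: (le_trans nt _ (Hu k).2).
apply: (fray_le nt fL); rewrite leqNgt; apply/negP => kn.
by apply: nk; exists k.
Qed.

End TreeGraph.

Lemma exists_normal_tree U : connected G -> U `<=` vset G ->
  (forall W c, W `<=` U -> conc G W -> ~ cdom G c W) ->
  exists (T : graph V) (r : V),
    [/\ normal_tree G T r, U `<=` vset T, rays_undominated G T,
        contains_cofinally T r U &
        forall K : graph V, is_component (del G T) K ->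
          finite_set (neighbourhood G K)].
Proof.
move=> cG UG nodom; have [[r Gr] _] := cG.
have [F0 [nt0 UF0 fin0]] := exists_ntree cG UG nodom Gr.
pose F := prune F0 U.
have nt : ntree G r F := ntree_prune U nt0.
have UF : U `<=` nodes F.
  move=> u Uu; apply/nodes_prune; split; first exact: UF0.
  by exists u => //; apply: le_refl; exact: UF0.
have cof x : nodes F x -> exists2 u, U u & le F x u.
  by move=> /nodes_prune[_ [u Uu xu]]; exists u => //; apply: le_prune => //; exact: UF.
exists (tgraph nt), r; split=> //.
- exact: tgraph_normal.
- exact: (tgraph_undominated nodom).
- by split=> // x /cof[u Uu xu]; exists u => //; exact: le_tree_le.
- by move=> K; apply: tgraph_component => d; exact: (nbr_prune nt0).
Qed.

End Pruning.

(** * Dominated combs *)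

Section DominatedCombs.
Context (V : choiceType) (G : graph V).
Implicit Types (x y z c d w r u v : V) (s l m : seq V) (W X Y Z A U : set V).
Implicit Types (P Q : vpath V).

(** * Edges of paths, fans and concatenated rays *)

Lemma zip_split a s x y : (x, y) \in zip (a :: s) s ->
  exists p q, a :: s = p ++ x :: y :: q.
Proof.
elim: s a => // b s IH a; rewrite [zip _ _]/= inE => /orP[/eqP[-> ->]|/IH].
  by exists [::], s.
by case=> p [q e]; exists (a :: p), q; rewrite e.
Qed.

Lemma pedge_split P x y : pedge P x y ->
  exists p q, pverts P = p ++ x :: y :: q \/ pverts P = p ++ y :: x :: q.
Proof.
by case/orP=> /zip_split[p [q e]]; exists p, q; [left|right].
Qed.

Lemma split_pedge P p q x y : pverts P = p ++ x :: y :: q -> pedge P x y.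
Proof.
case: P => a s; rewrite /pedge /pverts /= => e; apply/orP; left.
elim: p a s e => [a s [-> ->]|b p IH a s [_ es]].
  by rewrite /= mem_head.
by case: s es => [|a' s] es; [case: p es {IH}|rewrite /= inE; apply/orP; right; exact: IH].
Qed.

Lemma pedge_sym P x y : pedge P x y = pedge P y x.
Proof. by rewrite /pedge orbC. Qed.

Lemma pedge_mem P x y : pedge P x y -> x \in pverts P /\ y \in pverts P.
Proof.
by case/pedge_split=> p [q [->|->]]; rewrite !mem_cat !inE !eqxx !orbT.
Qed.

Lemma pedge_adj P x y : path (adj G) P.1 P.2 -> pedge P x y -> adj G x y.
Proof.
case: P => a s /= ps /pedge_split[[|b p] [q]]; rewrite /pverts /=.
  by case=> -[ea es]; move: ps; rewrite ea es /= => /andP[] //; rewrite adj_sym.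
case=> -[_ es]; move: ps; rewrite es cat_path /= => /and4P[_ _] //.
by rewrite adj_sym.
Qed.

Lemma path_pedge P : path (pedge P) P.1 P.2.
Proof.
suff H p a s : pverts P = p ++ a :: s -> path (pedge P) a s.
  exact: (H [::]).
elim: s p a => // b s IH p a e /=; rewrite (split_pedge e) /=.
by apply: (IH (rcons p a)); rewrite cat_rcons.
Qed.

Lemma path_vset x s z : vset G x -> path (adj G) x s -> z \in x :: s -> vset G z.
Proof.
move=> Gx ps zs; have av a : a \in x :: s -> ~ @set0 V a by move=> _ [].
exact: (reach_vset (path_reach ps av zs (mem_head _ _)) Gx).
Qed.

Section EdgeGraph.
Context (N : set V) (E : V -> V -> Prop).
Context (Esym : forall x y, E x y -> E y x).
Context (EG : forall x y, E x y -> adj G x y).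
Context (EN : forall x y, E x y -> N x).

Lemma exists_graph : exists H : graph V,
  vset H = N /\ forall x y, adj H x y <-> E x y.
Proof.
have esym : symmetric (fun x y => `[< E x y >]).
  by move=> x y; apply/asboolP/asboolP; exact: Esym.
have eirr : irreflexive (fun x y => `[< E x y >]).
  by move=> x; apply/asboolP => /EG; rewrite adj_irr.
have eN x y : `[< E x y >] -> N x by move/asboolP; exact: EN.
exists (Graph esym eirr eN); split=> // x y; split; last by move/asboolP.
by move/asboolP.
Qed.

End EdgeGraph.

(** Greedy choice: each new path from [c] avoids the finitely many other vertices used so far, and
    is cut at its first vertex after [c] in [A]. *)
Lemma fan c A :
  (forall Z, finite_set Z -> ~ Z c -> exists a, [/\ A a, a <> c & reach G Z c a]) ->
  exists (s : nat -> seq V) (a : nat -> V),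
    (forall n, [/\ path (adj G) c (rcons (s n) (a n)),
       uniq (c :: rcons (s n) (a n)), A (a n)
     & forall z, z \in s n -> ~ A z]) /\
    (forall i j z, z \in rcons (s i) (a i) -> z \in rcons (s j) (a j) -> i = j).
Proof.
move=> HA; pose good l (sa : seq V * V) := let: (s, a) := sa in
  [/\ path (adj G) c (rcons s a), uniq (c :: rcons s a), A a,
   forall z, z \in s -> ~ A z & forall z, z \in rcons s a -> z \notin l].
have /choice[f Hf] l : exists sa, c \notin l -> good l sa.
  have [cl|cl] := boolP (c \in l); first by exists ([::], c).
  have [|a [Aa ac /reach_uniq[s [ps us ls av]]]] := HA [set` l] (finite_seq l).
    exact/negP.
  have [|s1 [b [s2 [e Ab nA]]]] := @first_hit _ A s.
    exists a => //; move: (mem_last c s); rewrite ls inE => /orP[/eqP//|//].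
  exists (s1, b) => _.
  have e' : s = rcons s1 b ++ s2 by rewrite cat_rcons.
  split=> //.
  - by move: ps; rewrite e' cat_path => /andP[].
  - by move: us; rewrite e' -cat_cons cat_uniq => /andP[].
  - move=> z zs; apply/negP/av.
    by rewrite e' inE mem_cat zs orbT.
pose p l := rcons (f l).1 (f l).2.
(* [u n] lists the vertices other than [c] of the first [n] paths. *)
pose u := fix u n := if n is n'.+1 then p (u n') ++ u n' else [::].
have cu n : c \notin u n.
  elim: n => //= n cn; rewrite mem_cat negb_or cn andbT.
  by have := Hf _ cn; rewrite /p; case: (f _) => s a [_ /andP[]].
have sub i j z : (i < j)%N -> z \in p (u i) -> z \in u j.
  elim: j => // j IH; rewrite ltnS leq_eqVlt => /orP[/eqP->|/IH H] zp /=.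
    by rewrite mem_cat zp.
  by rewrite mem_cat H ?orbT.
have fresh n z : z \in p (u n) -> z \notin u n.
  by have := Hf _ (cu n); rewrite /p; case: (f _) => s a [_ _ _ _]; exact.
exists (fun n => (f (u n)).1), (fun n => (f (u n)).2); split.
  by move=> n; have := Hf _ (cu n); case: (f _) => s a [].
move=> i j z zi zj; case: (ltngtP i j) => // ij.
  by have := fresh j z zj; rewrite (sub i j z).
by have := fresh i z zi; rewrite (sub j i z).
Qed.

(** As no segment is empty, the first [n] segments have at least [n] vertices together, so the
    [k]-th vertex of the ray can be read off any long enough concatenation. *)
Lemma concat_ray (v : nat -> V) (e : nat -> seq V) :
  (forall n, [/\ path (adj G) (v n) (e n), last (v n) (e n) = v n.+1,
     e n != [::], uniq (e n) & v 0 \notin e n]) ->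
  (forall i j z, z \in e i -> z \in e j -> i = j) ->
  exists R, is_ray G R /\ range R = [set z | z = v 0 \/ exists n, z \in e n].
Proof.
move=> He disj; pose sp := fix sp n := if n is n'.+1 then sp n' ++ e n' else [::].
have sp_last n : last (v 0) (sp n) = v n.
  by elim: n => //= n IH; rewrite last_cat IH; case: (He n).
have sp_path n : path (adj G) (v 0) (sp n).
  by elim: n => //= n IH; rewrite cat_path IH sp_last; case: (He n).
have sp_mem n z : z \in sp n -> exists2 i, (i < n)%N & z \in e i.
  elim: n => //= n IH; rewrite mem_cat => /orP[/IH[i lin zi]|zn].
    by exists i => //; exact: ltnW.
  by exists n.
have sp_uniq n : uniq (v 0 :: sp n).
  elim: n => //= n /andP[vn un]; have [_ _ _ une ve] := He n.
  rewrite mem_cat negb_or vn ve cat_uniq un /= une andbT.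
  apply/hasPn => z zn; apply/negP => /sp_mem[i lin zi].
  by move: lin; rewrite (disj _ _ _ zi zn) ltnn.
have sp_size n : (n <= size (sp n))%N.
  elim: n => //= n IH; rewrite size_cat.
  have [_ _ + _ _] := He n; case: (e n) => // a t _ /=.
  by rewrite addnS ltnS; apply: leq_trans IH (leq_addr _ _).
have sp_pre i j : (i <= j)%N -> exists t, sp j = sp i ++ t.
  elim: j => [|j IH]; first by rewrite leqn0 => /eqP ->; exists [::].
  rewrite leq_eqVlt => /orP[/eqP->|/IH[t et]]; first by exists [::]; rewrite cats0.
  by exists (t ++ e j); rewrite /= et catA.
pose R k := nth (v 0) (v 0 :: sp k) k.
have RE k n : (k <= n)%N -> R k = nth (v 0) (v 0 :: sp n) k.
  by move=> /sp_pre[t ->]; rewrite -cat_cons nth_cat /= ltnS sp_size.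
exists R; split; first split.
- move=> i j; pose n := maxn i j.
  rewrite (RE i n) ?leq_maxl // (RE j n) ?leq_maxr // => /eqP.
  rewrite nth_uniq ?(sp_uniq n) //= ?ltnS; first by move=> /eqP.
    by apply: leq_trans (sp_size n); exact: leq_maxl.
  by apply: leq_trans (sp_size n); exact: leq_maxr.
- move=> n; rewrite (RE n n.+1) // (RE n.+1 n.+1) //.
  have /(pathP (v 0)) := sp_path n.+1; apply.
  by apply: leq_trans (sp_size n.+1).
- apply/seteqP; split=> [_ [k _ <-]|z /=].
    have : R k \in v 0 :: sp k by apply: mem_nth; rewrite /= ltnS sp_size.
    rewrite inE => /orP[/eqP->|/sp_mem[i _ Ri]]; first by left.
    by right; exists i.
  case=> [->|[n zn]]; first by exists 0.
  have zs : z \in v 0 :: sp n.+1 by rewrite /= inE mem_cat zn !orbT.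
  exists (index z (v 0 :: sp n.+1)) => //.
  pose k := index z (v 0 :: sp n.+1); rewrite -/k.
  rewrite (RE k (maxn k n.+1)) ?leq_maxl //.
  have [t ->] := sp_pre n.+1 (maxn k n.+1) (leq_maxr _ _).
  by rewrite -cat_cons nth_cat index_mem zs nth_index.
Qed.

(** * Combs in a set converging to an end *)

Section CombInConc.
Context (W : set V) (cW : conc G W).

(** For finite [Z], this places [x] in the component of [G - Z] that contains almost all of [W]. *)
Definition tends Z x := exists2 Y, finite_set Y &
  forall w, W w -> ~ Y w -> reach G Z x w.

Lemma tends_conc Z Y : finite_set Z -> finite_set Y ->
  exists w, [/\ W w, ~ Y w & tends Z w].
Proof.
move=> fZ fY; have [Y' fY' HY'] := cW.2 Z fZ.
have [|w Ww] := @infinite_nonempty_diff _ W (Y `|` Y') cW.1.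
  by rewrite finite_setU.
move=> nw; exists w; split=> //; first by move=> ?; apply: nw; left.
exists Y' => // w' Ww' nw'; apply: HY' => // ?; apply: nw; by right.
Qed.

Lemma tends_reach Z x y : tends Z x -> tends Z y -> reach G Z x y.
Proof.
move=> [X fX HX] [Y fY HY].
have [|w Ww nw] := @infinite_nonempty_diff _ W (X `|` Y) cW.1.
  by rewrite finite_setU.
apply: (reach_trans (HX w Ww _)); first by move=> ?; apply: nw; left.
by apply: reach_sym; apply: HY => // ?; apply: nw; right.
Qed.

Lemma tends_trans Z x y : reach G Z x y -> tends Z y -> tends Z x.
Proof.
move=> xy [Y fY HY]; exists Y => // w Ww nw.
exact: reach_trans xy (HY w Ww nw).
Qed.

Lemma tends_sub Z Z' x : Z `<=` Z' -> tends Z' x -> tends Z x.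
Proof.
move=> sub [Y fY HY]; exists Y => // w Ww nw.
exact: reach_sub sub (HY w Ww nw).
Qed.

Lemma tends_avoid Z x : tends Z x -> ~ Z x.
Proof. by move=> t; have [] := reach_avoid (tends_reach t t). Qed.

(* The spine is to be continued from [v], [l] being the vertices used so far. *)
Definition tip v l := v \in l /\ exists2 x, adj G v x & tends [set` l] x.

(** [v] is the last vertex in [l] of a walk from [w] to [w']; after it the walk avoids [l], so its
    successor tends to the end. *)
Lemma tip_exit l w w' : w \in l -> tends [set` l] w' ->
  forall Z, reach G Z w w' -> exists v, [/\ ~ Z v & tip v l].
Proof.
move=> wl tw' Z ww'.
have [v [x [vl wv vx xw']]] := reach_exit (A := [set` l]) ww' wl (tends_avoid tw').
exists v; split; first by case: (reach_avoid wv).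
split=> //; exists x => //; apply: tends_trans tw'.
by apply: reach_sub xw' => z; right.
Qed.

Lemma tip_start : exists v, tip v [:: v].
Proof.
have [w [Ww _ tw]] := tends_conc (finite_set0 V) (finite_set0 V).
have [w' [Ww' _ tw']] := tends_conc (finite_seq [:: w]) (finite_set0 V).
have [|v [_ tv]] := tip_exit (mem_head w [::]) tw' (Z := set0).
  by apply: tends_reach => //; apply: tends_sub tw'; exact: sub0set.
by exists v; have [+ _] := tv; rewrite inE => /eqP vw; move: tv; rewrite vw.
Qed.

(** From the tip, a path [q] runs outside [l] to some [w] in [W]. A walk from [w] that avoids [l]
    and goes on towards the end leaves the used vertices for the last time at [v'], which lies on
    [q]; the final piece [q2] then leads from [v'] to the tooth [w]. *)
Lemma tip_step v l : tip v l -> exists q1 v' q2, let q := q1 ++ v' :: q2 in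
  [/\ path (adj G) v q, uniq q, forall z, z \in q -> z \notin l,
      W (last v' q2) & tip v' (l ++ q)].
Proof.
move=> [vl [x vx tx]].
have [w [Ww _ tw]] := tends_conc (finite_seq l) (finite_set0 V).
have [s [ps us ls av]] := reach_uniq (tends_reach tx tw).
have [w' [Ww' _ tw']] := tends_conc (finite_seq (l ++ x :: s)) (finite_set0 V).
have sub : [set` l] `<=` [set` l ++ x :: s].
  by move=> z /= zl; rewrite mem_cat zl.
have [||v' [nv' tv']] := tip_exit (w := w) _ tw' (Z := [set` l]).
- by rewrite mem_cat -ls mem_last orbT.
- by apply: tends_reach tw _; exact: tends_sub tw'.
have : v' \in x :: s.
  by have [+ _] := tv'; rewrite mem_cat => /orP[/nv'|].
case/mem_cat_cons=> q1 [q2 e]; exists q1, v', q2; rewrite /= -e; split=> //.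
- by rewrite /= vx.
- by move=> z /av/negP.
- suff -> : last v' q2 = w by [].
  by rewrite -ls -[last x s]/(last x (x :: s)) e last_cat.
Qed.

(** Iteration of [tip_step]: the pieces of [q n] up to [v n.+1] will form the spine, from which
    [q2 n] branches off to a tooth. *)
Lemma comb_shape : exists (v : nat -> V) (q1 q2 : nat -> seq V),
  let q n := q1 n ++ v n.+1 :: q2 n in
  [/\ forall n, path (adj G) (v n) (q n), forall n, uniq (q n),
      forall n, v 0 \notin q n, forall n, W (last (v n.+1) (q2 n))
    & forall i j z, z \in q i -> z \in q j -> i = j].
Proof.
pose good (vl : V * seq V) (t : seq V * V * seq V) :=
  let: (v, l) := vl in let: (q1, v', q2) := t in let q := q1 ++ v' :: q2 in
  [/\ path (adj G) v q, uniq q, forall z, z \in q -> z \notin l,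
      W (last v' q2) & tip v' (l ++ q)].
have /choice[f Hf] vl : exists t, tip vl.1 vl.2 -> good vl t.
  case: vl => v l /=; have [/tip_step[q1 [v' [q2 H]]]|n] := pselect (tip v l).
    by exists (q1, v', q2).
  by exists ([::], v, [::]).
have [v0 tip0] := tip_start.
(* A state consists of the current tip and the list of vertices used so far. *)
pose next vl := ((f vl).1.2, vl.2 ++ (f vl).1.1 ++ (f vl).1.2 :: (f vl).2).
pose st n := iter n next (v0, [:: v0]).
have tip_st n : tip (st n).1 (st n).2.
  elim: n => //= n /Hf; rewrite -/(st n) /next; case: (st n) => v l.
  by case: (f _) => [[q1 v'] q2] [].
have goodn n := Hf _ (tip_st n).
pose q n := (f (st n)).1.1 ++ (st n.+1).1 :: (f (st n)).2.
have st2 n : (st n.+1).2 = (st n).2 ++ q n by [].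
have props n : [/\ path (adj G) (st n).1 (q n), uniq (q n),
    forall z, z \in q n -> z \notin (st n).2 & W (last (st n.+1).1 (f (st n)).2)].
  have := goodn n; rewrite /q /= -/(st n) /next.
  by case: (st n) => v l; case: (f _) => [[q1 v'] q2] [].
have sub i j z : (i < j)%N -> z \in q i -> z \in (st j).2.
  elim: j => // j IH; rewrite ltnS leq_eqVlt => /orP[/eqP->|/IH H] zq;
    rewrite st2 mem_cat; apply/orP; first by right.
  by left; exact: H.
have v0st n : v0 \in (st n).2.
  by elim: n => [|n IH]; rewrite ?mem_head // st2 mem_cat IH.
exists (fun n => (st n).1), (fun n => (f (st n)).1.1), (fun n => (f (st n)).2).
split.
- by move=> n; case: (props n).
- by move=> n; case: (props n).
- by move=> n; apply/negP => vq; have [_ _ /(_ _ vq)] := props n; rewrite v0st.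
- by move=> n; case: (props n).
- move=> i j z zi zj; case: (ltngtP i j) => // ij.
    by have [_ _ /(_ _ zj)] := props j; rewrite (sub i j z).
  by have [_ _ /(_ _ zi)] := props i; rewrite (sub j i z).
Qed.

Lemma conc_comb : exists K T, [/\ is_comb K T, subgraph K G, T `<=` W & infinite_set T].
Proof.
have [v [q1 [q2 [pq uq v0q Wq disj]]]] := comb_shape.
pose q n := q1 n ++ v n.+1 :: q2 n.
have qE n : q n = rcons (q1 n) (v n.+1) ++ q2 n by rewrite cat_rcons.
have [||R [rayR rangeR]] := @concat_ray v (fun n => rcons (q1 n) (v n.+1)).
- move=> n; move: (pq n) (uq n) (v0q n); rewrite -/(q n) qE.
  rewrite cat_path cat_uniq mem_cat negb_or last_rcons.
  move=> /andP[-> _] /andP[-> _] /andP[-> _]; split=> //.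
  by case: (q1 n).
- move=> i j z zi zj; apply: (disj i j z).
    by rewrite -/(q i) qE mem_cat zi.
  by rewrite -/(q j) qE mem_cat zj.
pose P n : vpath V := (v n.+1, q2 n).
have Pq n z : z \in pverts (P n) -> z \in q n.
  by rewrite mem_cat => ->; rewrite orbT.
have pP n : path (adj G) (v n.+1) (q2 n).
  by have := pq n; rewrite cat_path /= => /and3P[].
have uP n : uniq (pverts (P n)).
  by have := uq n; rewrite cat_uniq => /and3P[].
pose Ps := range P.
have Pinj i j z : z \in pverts (P i) -> z \in pverts (P j) -> i = j.
  by move=> /Pq zi /Pq; exact: disj.
have iPs (B : Type) (g : nat -> B) : (forall i j, g i = g j -> i = j) ->
    infinite_set (range g).
  move=> inj; apply: infinite_image_inj; first exact: infinite_nat.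
  by move=> i j _ _; exact: inj.
have PR n z : z \in pverts (P n) -> range R z -> z = v n.+1.
  move=> zP; rewrite rangeR => -[zv|[i zi]].
    by have := v0q n; rewrite -zv -/(q n) Pq.
  have zqi : z \in q i by rewrite qE mem_cat zi.
  have ei := disj _ _ _ zqi (Pq _ _ zP); subst i.
  move: zi; rewrite mem_rcons inE => /orP[/eqP//|zq1].
  have := uq n; rewrite cat_uniq => /and3P[_ /hasPn /(_ _ zP)].
  by rewrite /= zq1.
pose E x y := redge R x y \/ exists2 Q, Ps Q & pedge Q x y.
pose N := range R `|` \bigcup_(Q in Ps) [set` pverts Q].
have Esym x y : E x y -> E y x.
  case=> [[n H]|[Q PsQ]]; first by left; exists n; case: H; [right|left].
  by rewrite pedge_sym; right; exists Q.
have EG x y : E x y -> adj G x y.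
  case=> [[n [[-> ->]|[-> ->]]]|[_ [n _ <-]]].
  - by case: rayR.
  - by rewrite adj_sym; case: rayR.
  - exact: (pedge_adj (P := P n) (pP n)).
have EN x y : E x y -> N x.
  case=> [[n [[-> _]|[_ ->]]]|[Q PsQ /pedge_mem[xQ _]]].
  - by left; exists n.
  - by left; exists n.+1.
  - by right; exists Q.
have [K [vK aK]] := exists_graph Esym EG EN.
have RG n : vset G (R n) by have [_ H] := rayR; exact: adj_vset (H n).
have vR n : range R (v n.+1).
  by rewrite rangeR; right; exists n; rewrite mem_rcons mem_head.
exists K, [set plast Q | Q in Ps]; split.
- exists R, Ps; split=> //.
  + by split; [case: rayR|move=> n; apply/aK; left; exists n; left].
  + by apply: iPs => i j e; apply: (Pinj _ _ (v i.+1)); rewrite -?e mem_head.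
  + move=> _ [n _ <-]; split.
      split=> //; first by rewrite vK; left; exact: vR.
      by apply: sub_path (path_pedge (P n)) => x y xy; apply/aK; right; exists (P n) => //; exists n.
    apply/seteqP; split=> [z [zP Rz]|_ ->]; first exact: PR zP Rz.
    by split; [exact: mem_head|exact: vR].
  + move=> _ _ [i _ <-] [j _ <-] ij; rewrite -subset0 => z [zi zj].
    by apply: ij; rewrite (Pinj _ _ _ zi zj).
- split=> [z|x y /aK/EG//]; rewrite vK => -[[n _ <-]|[_ [n _ <-] zP]]; first exact: RG.
  apply: path_vset (pP n) zP; have [k _ <-] := vR n; exact: RG.
- by move=> _ [_ [n _ <-] <-]; exact: Wq.
- rewrite (_ : [set _ | _ in _] = range (fun n => plast (P n))).
    apply: iPs => i j e; apply: (Pinj _ _ (plast (P i))); first exact: mem_last.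
    by rewrite e; exact: mem_last.
  apply/seteqP; split=> [_ [_ [n _ <-] <-]|_ [n _ <-]]; first by exists n.
  by exists (P n) => //; exists n.
Qed.

End CombInConc.

(** A fan from [c] to [W] is the star. Its ends again converge, so a comb can be built with all
    teeth among them, and these are leaves. *)
Lemma dominated_comb U W c : W `<=` U -> conc G W -> cdom G c W ->
  has_dominated_comb G U.
Proof.
move=> WU cW dW.
have [|s [a [Hsa disj]]] := @fan c W.
  move=> Z fZ nZ; have [Y fY HY] := dW Z fZ nZ.
  have [|w Ww nw] := @infinite_nonempty_diff _ W (Y `|` [set c]) cW.1.
    by rewrite finite_setU; split=> //; exact: finite_set1.
  exists w; split=> // [wc|]; first by apply: nw; right.
  by apply: HY => // ?; apply: nw; left.
have ain n : a n \in rcons (s n) (a n) by rewrite mem_rcons mem_head.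
have ainj i j : a i = a j -> i = j.
  by move=> e; apply: (disj _ _ (a i)) => //; rewrite e.
have ia : infinite_set (range a).
  apply: infinite_image_inj; first exact: infinite_nat.
  by move=> i j _ _; exact: ainj.
have aW : range a `<=` W by move=> _ [n _ <-]; case: (Hsa n).
have [K [T [combK KG Ta iT]]] := conc_comb (conc_sub aW ia cW).
exists K, T; split=> //; first by move=> t /Ta/aW/WU.
pose P n : vpath V := (c, rcons (s n) (a n)); pose Ps := range P.
have pP n : path (adj G) c (rcons (s n) (a n)) by case: (Hsa n).
have uP n : uniq (pverts (P n)) by case: (Hsa n).
pose E x y := exists2 Q, Ps Q & pedge Q x y.
pose N := \bigcup_(Q in Ps) [set` pverts Q].
have Esym x y : E x y -> E y x by case=> Q PsQ; rewrite pedge_sym; exists Q.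
have EG x y : E x y -> adj G x y by case=> _ [n _ <-]; exact: (pedge_adj (P := P n) (pP n)).
have EN x y : E x y -> N x by case=> Q PsQ /pedge_mem[xQ _]; exists Q.
have [S [vS aS]] := exists_graph Esym EG EN.
have Gc : vset G c.
  by have := pP 0; case: (rcons _ _) (ain 0) => // b t _ /= /andP[/adj_vset].
have cP n : [set` pverts (P n)] c by exact: mem_head.
exists S; split.
- exists c, Ps; split=> //.
  + apply: infinite_image_inj; first exact: infinite_nat.
    by move=> i j _ _ [] e; apply: (disj _ _ (a i)) => //; rewrite -e.
  + move=> _ [n _ <-]; split=> //; last by rewrite /plength size_rcons.
    split=> //; first by rewrite vS; exists (P n) => //; exists n.
    by apply: sub_path (path_pedge (P n)) => x y xy; apply/aS; exists (P n) => //; exists n.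
  + move=> _ _ [i _ <-] [j _ <-] ij; apply/seteqP; split=> [z|_ ->]; last by split.
    rewrite /= !in_cons => -[/orP[/eqP//|zi] /orP[/eqP//|zj]].
    by case: ij; rewrite (disj _ _ _ zi zj).
- split=> [z|x y /aS/EG//]; rewrite vS => -[_ [n _ <-] zP].
  exact: path_vset (pP n) zP.
suff TL : T `<=` leaves S by rewrite (setIidr TL).
move=> _ /Ta[n _ <-]; split.
  by rewrite vS; exists (P n); [exists n|rewrite /= in_cons ain orbT].
have an_c : a n <> c.
  by move=> e; have := uP n; rewrite /pverts /= -e ain.
exists (last c (s n)); split.
  apply/aS; exists (P n); first by exists n.
  rewrite pedge_sym; apply: (split_pedge (p := belast c (s n)) (q := [::])).
  by rewrite /pverts /= -rcons_cons lastI -cats1 -cats1 -catA.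
move=> y /aS[_ [i _ <-] ed].
have : a n \in pverts (P i) by case: (pedge_mem ed).
rewrite in_cons => /orP[/eqP//|ani].
have ein := disj _ _ _ ani (ain n); subst i.
have eP : pverts (P n) = (c :: s n) ++ a n :: [::] by rewrite /pverts /= cats1.
(* As [a n] occurs only once, at the end of its path, the edge must be the last one. *)
have [p [q [e|e]]] := pedge_split ed.
  have : [::] = y :: q.
    by apply: (@uniq_suffix _ (c :: s n) p (a n)); rewrite -eP.
  by [].
have q0 : [::] = q.
  apply: (@uniq_suffix _ (c :: s n) (rcons p y) (a n)); first by rewrite -eP.
  by rewrite -eP e cat_rcons.
move: e; rewrite eP cats1 -q0 -cat_rcons cats1 => /rcons_inj[e].
by rewrite -[last c (s n)]/(last c (c :: s n)) e last_rcons.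
Qed.

End DominatedCombs.

(** * Dominated combs exclude normal trees with undominated rays *)

Section Exclusion.
Context (V : choiceType) (G : graph V).
Implicit Types (x y z c d w r u v : V) (s l m : seq V) (W X Y Z A U : set V).
Implicit Types (P Q : vpath V).

(** The first vertices of the paths converge along the spine; [f] shifts them along the disjoint
    paths to the teeth, which preserves convergence. *)
Lemma comb_conc K W : is_comb K W -> subgraph K G -> conc G W.
Proof.
move=> [R [Ps [[Rinj Radj] iPs HP disj [_ _ WE]]]] [_ KG].
have cR : conc G (range R).
  by apply: ray_conc; split=> // n; apply: KG.
have inj P Q z : Ps P -> Ps Q -> z \in pverts P -> z \in pverts Q -> P = Q.
  move=> PsP PsQ zP zQ; apply: contrapT => PQ.
  have : ([set` pverts P] `&` [set` pverts Q]) z by [].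
  by rewrite disj.
have /choice[p Hp] z : exists P, (exists2 Q, Ps Q & z \in pverts Q) ->
    Ps P /\ z \in pverts P.
  have [[Q]|n] := pselect (exists2 Q, Ps Q & z \in pverts Q); first by exists Q.
  by exists (z, [::]).
have pE P z : Ps P -> z \in pverts P -> p z = P.
  move=> PsP zP; have [|Pp zp] := Hp z; first by exists P.
  exact: (inj _ _ z).
have fP P : pfirst P \in pverts P by exact: mem_head.
have lP P : plast P \in pverts P by exact: mem_last.
pose f z := plast (p z).
have WE' : W = f @` (@pfirst V @` Ps).
  rewrite WE; apply/seteqP; split=> [_ [P PsP <-]|_ [_ [P PsP <-] <-]].
    by exists (pfirst P); [exists P|rewrite /f (pE P)].
  by exists P => //; rewrite /f (pE P).
have iW : infinite_set W.
  rewrite WE; apply: infinite_image_inj => // P Q PsP PsQ e.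
  by apply: (inj _ _ (plast P)) => //; rewrite e.
rewrite WE'; apply: conc_image.
- apply: conc_sub cR.
    move=> _ [P PsP <-]; have [_ e] := HP _ PsP.
    have : ([set` pverts P] `&` range R) (pfirst P) by rewrite e.
    by case.
  apply: infinite_image_inj => // P Q PsP PsQ e.
  by apply: (inj _ _ (pfirst P)) => //; rewrite e.
- by rewrite -WE'.
- move=> _ Z [P PsP <-] _; rewrite /f (pE P) // => HZ.
  have [[_ pP _] _] := HP _ PsP.
  apply: (path_reach (x := P.1) (s := P.2)) => //; first exact: sub_path pP.
  by move=> z zP Zz; apply: (HZ z Zz); rewrite (pE P).
Qed.

(** If the paths part at the first step, following the first one up to its first vertex [z] on the
    second and returning along the second closes a cycle. *)
Lemma acyclic_path (T : graph V) : acyclic T -> forall x s s',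
  path (adj T) x s -> path (adj T) x s' -> uniq (x :: s) -> uniq (x :: s') ->
  last x s = last x s' -> s = s'.
Proof.
move=> acy x s; elim: s x => [|a s IH] x [|a' s'] //.
- by move=> _ _ _ /= /andP[+ _] e; rewrite e mem_last.
- by move=> _ _ /= /andP[+ _] _ e; rewrite -e mem_last.
move=> ps ps' us us' e.
have [aa|/eqP aa] := eqVneq a a'.
  move: ps ps' us us' e; rewrite -aa /= => /andP[_ ps] /andP[_ ps'].
  by move=> /andP[_ us] /andP[_ us'] e; rewrite (IH a s').
have [|s1 [z [s2 [es zs' nz]]]] := @first_hit _ [set` a' :: s'] (a :: s).
  exists (last a s); first exact: mem_last.
  by move: e => /= ->; exact: mem_last.
have [t1 [t2 et]] := mem_cat_cons zs'.
have pz : path (adj T) x (rcons s1 z).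
  by move: ps; rewrite es -cat_rcons cat_path => /andP[].
have pz' : path (adj T) x (rcons t1 z).
  by move: ps'; rewrite et -cat_rcons cat_path => /andP[].
have uz : uniq (x :: rcons s1 z).
  by move: us; rewrite es -cat_rcons -cat_cons cat_uniq => /andP[].
have uz' : uniq (x :: rcons t1 z).
  by move: us'; rewrite et -cat_rcons -cat_cons cat_uniq => /andP[].
have /acy : ucycle (adj T) (x :: rcons s1 z ++ rev t1).
  apply/andP; split.
    rewrite /= rcons_cat cat_path pz last_rcons /=.
    have -> : rcons (rev t1) x = rev (belast x (rcons t1 z)).
      by rewrite belast_rcons rev_cons.
    rewrite -[z in path _ z _](last_rcons x t1 z) rev_path.
    by rewrite (eq_path (e' := adj T)) // => ? ?; exact: adj_sym.
  rewrite -cat_cons cat_uniq uz rev_uniq.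
  move: uz'; rewrite /= rcons_uniq mem_rcons inE negb_or.
  move=> /and3P[/andP[_ xt] zt ->]; rewrite andbT.
  apply/hasPn => y; rewrite mem_rev => yt; apply/negP.
  rewrite /= inE mem_rcons inE => /or3P[/eqP yx|/eqP yz|ys1].
  - by move: xt; rewrite -yx yt.
  - by move: zt; rewrite -yz yt.
  - by apply: (nz y ys1); rewrite /= et mem_cat yt.
(* Length at most two leaves nothing between [x] and [z] on either path, so both first steps lead to
   [z]. *)
rewrite /= size_cat size_rcons size_rev addSn !ltnS leqn0 addn_eq0.
move=> /andP[/nilP e1 /nilP e2]; case: aa.
by move: es et; rewrite e1 e2 => -[-> _] [-> _].
Qed.

(** This brings a rooted tree given as a graph into the form required by [ntree]. *)
Definition paths_to (T : graph V) r : set (seq V) := [set m | exists x t,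
  [/\ m = x :: t, vset T x, path (adj T) x t, uniq (x :: t) & last x t = r]].

Lemma paths_to_cons (T : graph V) r x t : paths_to T r (x :: t) <->
  [/\ vset T x, path (adj T) x t, uniq (x :: t) & last x t = r].
Proof.
by split=> [[_ [_ [[<- <-] ? ? ? ?]]]|[? ? ? ?]]; [split|exists x, t; split].
Qed.

Lemma nodes_paths_to (T : graph V) r : connected T -> vset T r ->
  nodes (paths_to T r) = vset T.
Proof.
move=> cT Tr; apply/seteqP; split=> [x [t /paths_to_cons[]]//|x Tx].
have [t [pt ut lt _]] := reach_uniq (connected_reach cT Tx Tr).
by exists t; apply/paths_to_cons.
Qed.

Lemma tree_le_le (T : graph V) r x y : vset T y -> tree_le T r x y ->
  le (paths_to T r) x y.
Proof.
move=> Ty [[a s] [[_ /= ps us] ar sy xs]].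
rewrite /pfirst /plast /pverts /= in ar sy us xs; subst a.
have e : rev (r :: s) = y :: rev (belast r s) by rewrite (lastI r s) rev_rcons sy.
exists (rev (belast r s)); last by rewrite -e mem_rev.
apply/paths_to_cons; split=> //.
- rewrite -sy rev_path (eq_path (e' := adj T)) // => ? ?; exact: adj_sym.
- by rewrite -e rev_uniq.
- by rewrite -[LHS]/(last r (y :: rev (belast r s))) -e rev_cons last_rcons.
Qed.

(** Uniqueness of paths in a tree gives [nt_fun]; distinct linked nodes are the ends of a [T]-path,
    to which the normality of [T] applies. *)
Lemma ntree_paths_to (T : graph V) r : is_tree T -> vset T r ->
  normal_tree G T r -> ntree G r (paths_to T r).
Proof.
move=> [cT aT] Tr [_ [TG TadjG] norm]; have nE := nodes_paths_to cT Tr.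
split.
- by case=> [x [t []]].
- by move=> x s /paths_to_cons[_ ps _ _]; exact: sub_path ps.
- by move=> x s /paths_to_cons[].
- by move=> x s /paths_to_cons[].
- move=> x y s /paths_to_cons[Tx /= /andP[xy ps] /andP[_ us] ls].
  apply/paths_to_cons; split=> //; rewrite adj_sym in xy; exact: adj_vset xy.
- move=> x s s' /paths_to_cons[_ ps us ls] /paths_to_cons[_ ps' us' ls'].
  by apply: (acyclic_path aT (x := x)) => //; rewrite ls ls'.
rewrite nE => x y Tx Ty lnk.
have [xy|/eqP xy] := eqVneq x y.
  by left; rewrite -xy; apply: le_refl; rewrite nE.
suff [P [tP Px Py]] : exists P, [/\ is_Tpath G T P, pfirst P = x & plast P = y].
  by have := norm _ tP; rewrite Px Py => -[]; [left|right]; exact: tree_le_le.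
case: lnk => [adjxy|[c [d [xc /reach_uniq[s [ps us ls av]] dy]]]].
  exists (x, [:: y]); split=> //; split=> //.
    by split; rewrite /pverts /= ?adjxy ?inE ?andbT; [exact: TG|by []|exact/eqP].
  apply/seteqP; split=> [z [/=]|z]; rewrite /pfirst /plast /=.
    by rewrite !inE => /orP[]/eqP-> _; [left|right].
  by case=> ->; rewrite /= !inE eqxx ?orbT.
exists (x, rcons (c :: s) y); split=> //; last by rewrite /plast last_rcons.
have nT z : vset T z -> z \notin c :: s by move=> Tz; apply/negP => /av.
split=> //.
- split; first exact: TG.
    by rewrite rcons_path /= xc ps ls.
  rewrite /pverts cons_uniq rcons_uniq us andbT mem_rcons in_cons negb_or !nT //.
  by rewrite !andbT; exact/eqP.
- apply/seteqP; split=> [z [/=]|z].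
    rewrite /pfirst /plast /= last_rcons in_cons -rcons_cons mem_rcons in_cons.
    by case/or3P=> [/eqP->|/eqP->|zs] Tz; [left|right|case/negP: (nT z Tz)].
  rewrite /pfirst /plast /= last_rcons => -[->|->]; split=> //=.
    exact: mem_head.
  by rewrite in_cons -rcons_cons mem_rcons mem_head orbT.
Qed.

Lemma comb_tree_exclusive U : ~ (has_dominated_comb G U /\ has_normal_tree G U).
Proof.
move=> [[K [W [combK KG WU [S [starS [SG SadjG] iSW]]]]] [T [r [nT UT undom]]]].
have [c [Ps [iPs HP disj SE _]]] := starS.
(* On these vertices the comb gives convergence to an end, and the star makes [c] dominate that
   end. *)
set W2 := leaves S `&` W in iSW.
have cW2 : conc G W2 by apply: conc_sub (comb_conc combK KG) => // w [].
have pathG P : Ps P -> is_path G P /\ pfirst P = c.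
  move=> /HP[[SP pP uP] Pc _]; split=> //; split=> //; first exact: SG.
  exact: sub_path pP.
have dW2 : cdom G c W2.
  by apply: (star_cdom (Ps := Ps)) => // w [[+ _] _]; rewrite SE.
have Gc : vset G c.
  by have [P /pathG[[GP _ _] <-]] := infinite_setN0 iPs.
have W2T : W2 `<=` vset T by move=> w [_ /WU/UT].
have [T0|[treeT Tr]] : rooted_tree T r by case: nT.
  by have [w /W2T] := infinite_setN0 iSW; rewrite T0.
have nt := ntree_paths_to treeT Tr nT.
have [cT _] := treeT.
have [L fL almost] : exists2 L, fray (paths_to T r) L & forall n,
    finite_set (W2 `&` [set w | ~ le (paths_to T r) (L n) w]).
  by apply: (conc_ray nt cW2); rewrite nodes_paths_to.
apply: (undom L).
  split; first exact: (fray_inj nt fL).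
  move=> n; have [s /paths_to_cons[_ /= /andP[+ _] _ _]] := fL n.
  by rewrite adj_sym.
exists c => //.
(* For each finite [Z] without [c], some [L n] is reached from [c] by way of a vertex [w] of [W2]
   above it; hence there is a fan from [c] to the ray. *)
have [|s [a [Hsa sdisj]]] := @fan _ G c (range L).
  move=> Z fZ nZ; have [Y fY HY] := dW2 Z fZ nZ.
  have [|n Hn] := fray_avoid nt fL (Z := Z `|` [set c]).
    by rewrite finite_setU; split=> //; exact: finite_set1.
  have [w Ww nw] : exists2 w, W2 w &
      ~ (Y `|` W2 `&` [set w | ~ le (paths_to T r) (L n) w]) w.
    by apply: infinite_nonempty_diff => //; rewrite finite_setU.
  have Lw : le (paths_to T r) (L n) w.
    by apply: contrapT => nle; apply: nw; right.
  exists (L n); split.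
  - by exists n.
  - move=> Lc; apply: (Hn n c (leqnn n)); first by right.
    by rewrite -Lc; exact/le_refl/(fray_node nt fL).
  - apply: (reach_trans (HY w Ww _)); first by move=> ?; apply: nw; left.
    apply: reach_sym; apply: (le_reach nt Lw) => z Zz.
    by apply: Hn => //; left.
pose P n : vpath V := (c, rcons (s n) (a n)).
have aP n : a n \in rcons (s n) (a n) by rewrite mem_rcons mem_head.
have ac n : a n <> c.
  by have [_ + _ _] := Hsa n => /= /andP[+ _] e; rewrite -e aP.
have lastP n : plast (P n) = a n by rewrite /plast last_rcons.
exists (range P); split.
- apply: infinite_image_inj; first exact: infinite_nat.
  by move=> i j _ _ [] e; apply: (sdisj _ _ (a i)) => //; rewrite -e.
- move=> _ [n _ <-]; have [pn un Ln sn] := Hsa n; split=> //.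
  rewrite lastP; apply/seteqP; split=> [z [/= + [Lz /= zc]]|_ ->].
    by rewrite in_cons mem_rcons in_cons => /or3P[/eqP//|/eqP->//|/sn].
  split; first by rewrite /= in_cons aP orbT.
  by split; [exact: Ln|exact: ac].
- move=> _ _ [i _ <-] [j _ <-] ij; apply/seteqP; split=> [z|_ ->].
    rewrite /= !in_cons => -[/orP[/eqP//|zi] /orP[/eqP//|zj]].
    by case: ij; rewrite (sdisj _ _ _ zi zj).
  by split; exact: mem_head.
Qed.

End Exclusion.

Theorem theorem1 (V : choiceType) (G : graph V) (U : set V)
    (Gconn : connected G) (UG : U `<=` vset G) :
  ((has_dominated_comb G U \/ has_normal_tree G U) /\
   ~ (has_dominated_comb G U /\ has_normal_tree G U)) /\
  (has_normal_tree G U ->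
   exists (T : graph V) (r : V),
     [/\ normal_tree G T r, U `<=` vset T, rays_undominated G T,
         contains_cofinally T r U &
         forall K : graph V, is_component (del G T) K ->
           finite_set (neighbourhood G K)]).
Proof.
have excl := @comb_tree_exclusive V G U.
have strong : ~ has_dominated_comb G U -> exists (T : graph V) (r : V),
    [/\ normal_tree G T r, U `<=` vset T, rays_undominated G T,
        contains_cofinally T r U &
        forall K : graph V, is_component (del G T) K ->
          finite_set (neighbourhood G K)].
  move=> ndom; apply: exists_normal_tree => // W c WU cW dW.
  exact/ndom/(dominated_comb WU cW dW).
split; last by move=> tree; apply: strong => dom; exact: excl.
split=> //; have [dom|/strong[T [r [nT UT undom _ _]]]] :=
  pselect (has_dominated_comb G U); first by left.
by right; exists T, r; split.
Qed.
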